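(* Let $P_1,\ldots,P_r\subseteq\mathbb{R}^d$ be polyhedra and $\alpha_1,\ldots,\alpha_r\in\mathbb{R}$ such that the indicator functions satisfy $$\sum_{i=1}^r\alpha_i[P_i]=0$$ as functions on $\mathbb{R}^d$. Then $$\sum_{i=1}^r\alpha_i\,\mathrm{Vol}^\vee_{\mathbf z}(P_i)=0$$ as a rational function of $\mathbf z=(z_1,\ldots,z_d)$. If moreover each $P_i$ is non-codegenerate, then $$\sum_{i=1}^r\alpha_i\,\mathrm{Vol}^\vee(P_i)=0 .$$
   Context: A polyhedron in $\mathbb{R}^d$ is a non-empty intersection of finitely many closed half-spaces (possibly unbounded, possibly lower-dimensional, possibly containing lines). $[S]$ denotes the indicator function of $S\subseteq\mathbb{R}^d$. Support function: $h_P(\mathbf v)=-\min_{\mathbf y\in P}\langle \mathbf v,\mathbf y\rangle\in\mathbb{R}\cup\{\infty\}$. The normal fan $\mathcal N(P)$ consists of the cones $C_F=\{\mathbf v: h_P(\mathbf v)=-\langle \mathbf v,\mathbf y\rangle\neq\infty \text{ for every }\mathbf y\in F\}$, $F$ a face of $P$. $P$ is non-codegenerate if $\mathbf 0$ is not contained in the affine span of any facet of $P$. For full-dimensional $P$: if $\mathcal N(P)$ is pure of dimension $d$, then $$\mathrm{Vol}^\vee_{\mathbf z}(P)=\sum_{C=\mathrm{span}_{\ge0}(\mathbf v_{1},\dots,\mathbf v_{d})\in\mathcal T}\frac{|\det(\mathbf v_{1},\dots,\mathbf v_{d})|}{\prod_{j=1}^d\bigl(h_P(\mathbf v_{j})+\langle\mathbf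 v_{j},\mathbf z\rangle\bigr)},$$ where $\mathcal T$ is any triangulation of $\mathcal N(P)$ into full-dimensional simplicial cones generated by rays of $\mathcal N(P)$ (the result does not depend on $\mathcal T$ or on the scaling of ray generators); if $\mathcal N(P)$ is pure of dimension $<d$ (i.e. $P$ contains a line), then $\mathrm{Vol}^\vee_{\mathbf z}(P)=0$. If $P$ is not full-dimensional, $\mathrm{Vol}^\vee_{\mathbf z}(P)=0$. For non-codegenerate $P$, $\mathrm{Vol}^\vee(P)$ is the value of $\mathrm{Vol}^\vee_{\mathbf z}(P)$ at $\mathbf z=\mathbf 0$ (and it is $0$ if $P$ is not full-dimensional). *)

(* Defs.v *)
From mathcomp Require Import all_boot all_order all_algebra.
From mathcomp Require Import fraction.
From mathcomp Require Import boolp classical_sets reals ereal numfun.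
(* The notations of mpoly clash with those of MathComp-Analysis. *)
From mathcomp Require Import -(notations) mpoly.

Set Implicit Arguments.
Unset Strict Implicit.
Unset Printing Implicit Defensive.

Import Order.TTheory GRing.Theory Num.Theory.
Local Open Scope classical_set_scope.
Local Open Scope ring_scope.

Section Polyhedra.
Context {R : realType} {d : nat}.
Implicit Types (P F S : set 'rV[R]_d) (N : set (set 'rV[R]_d)).
Implicit Types (v x y z : 'rV[R]_d).

Definition dot x y : R := \sum_(j < d) x 0 j * y 0 j.

Definition halfspace (a : 'rV[R]_d) (b : R) : set 'rV[R]_d :=
  [set y | dot a y <= b].

Definition polyhedron P : Prop :=
  P !=set0 /\
  exists (m : nat) (a : 'I_m -> 'rV[R]_d) (b : 'I_m -> R),
    (forall i, a i != 0) /\ P = [set y | forall i, halfspace (a i) (b i) y].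

(* The dimension of the linear span of S. *)
Definition lin_dim S : nat :=
  (\max_(k < d.+1 | `[< exists A : 'M[R]_(k, d),
                          row_free A /\ forall i, S (row i A) >]) k)%N.

(* The dimension of the affine span of S, for S nonempty. *)
Definition aff_dim S : nat := lin_dim [set x - y | x in S & y in S].

Definition aff_span S : set 'rV[R]_d :=
  [set x | exists (n : nat) (y : 'I_n -> 'rV[R]_d) (c : 'I_n -> R),
     [/\ forall i, S (y i), \sum_i c i = 1 & x = \sum_i c i *: y i]].

Definition full_dimensional P : Prop := aff_dim P = d.

(* Faces are nonempty, and P is a face of itself (take a = 0 and b = 0). *)
Definition face P F : Prop :=
  F !=set0 /\
  exists (a : 'rV[R]_d) (b : R),
    (forall y, P y -> b <= dot a y) /\ F = [set y | P y /\ dot a y = b].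

Definition facet P F : Prop := face P F /\ (aff_dim F).+1 = aff_dim P.

Definition non_codegenerate P : Prop :=
  forall F, facet P F -> ~ aff_span F 0.

(* On a polyhedron the infimum is either attained or equal to -oo. *)
Definition support_fun P v : \bar R :=
  (- ereal_inf [set (dot v y)%:E | y in P])%E.

Definition normal_cone P F : set 'rV[R]_d :=
  [set v | support_fun P v <> +oo%E /\
           forall y, F y -> support_fun P v = (- dot v y)%:E].

Definition normal_fan P : set (set 'rV[R]_d) :=
  [set C | exists2 F, face P F & C = normal_cone P F].

Definition pure N (k : nat) : Prop :=
  forall C, N C -> (forall D, N D -> C `<=` D -> D = C) -> lin_dim C = k.

(* The cone generated by the rows of V. *)
Definition cone_of (k : nat) (V : 'M[R]_(k, d)) : set 'rV[R]_d :=
  [set x | exists c : 'rV[R]_k, (forall j, 0 <= c 0 j) /\ x = c *m V].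

Definition ray_generator N v : Prop := v != 0 /\ N (cone_of v).

(* The rows of T i are generators of the i-th maximal cone. *)
Definition triangulation N (m : nat) (T : 'I_m -> 'M[R]_d) : Prop :=
  [/\ forall i, \det (T i) != 0 /\ forall j, ray_generator N (row j (T i)),
      forall i, exists2 C, N C & cone_of (T i) `<=` C,
      [set x | exists i, cone_of (T i) x] = [set x | exists2 C, N C & C x],
      forall i j, cone_of (T i) = cone_of (T j) -> i = j
    & forall i j, face (cone_of (T i)) (cone_of (T i) `&` cone_of (T j))].

(* Rational functions of z are elements of the fraction field of the ring of
   polynomials in z_1, ..., z_d. *)
Local Notation ratfun := {fraction (mpoly d R)}.

Definition ratfun_cst (a : R) : ratfun := tofrac (mpolyC d a).

Definition support_form P v : mpoly d R :=
  mpolyC d (fine (support_fun P v))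
  + \sum_(j < d) v 0 j *: mpolyX R (mnm1 j).

Definition triangulation_sum P (m : nat) (T : 'I_m -> 'M[R]_d) : ratfun :=
  \sum_(i < m) ratfun_cst `|\det (T i)|
               / \prod_(j < d) tofrac (support_form P (row j (T i))).

Definition is_dual_volume_z P (f : ratfun) : Prop :=
  [\/ [/\ full_dimensional P, pure (normal_fan P) d &
          exists (m : nat) (T : 'I_m -> 'M[R]_d),
            triangulation (normal_fan P) T /\ f = triangulation_sum P T],
      [/\ full_dimensional P,
          exists k, (k < d)%N /\ pure (normal_fan P) k & f = 0]
    | ~ full_dimensional P /\ f = 0].

Definition dual_volume_z P : ratfun := xget 0 (is_dual_volume_z P).

(* a is the value of f at z: f is regular at z and f(z) = a. *)
Definition ratfun_value (f : ratfun) z (a : R) : Prop :=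
  exists p q : mpoly d R,
    [/\ meval (z 0) q != 0, f = tofrac p / tofrac q
      & a = meval (z 0) p / meval (z 0) q].

Definition dual_volume P : R := xget 0 (ratfun_value (dual_volume_z P) 0).

End Polyhedra.

(* Main.v *)
Require Import Defs.
From mathcomp Require Import all_boot all_order all_algebra.
From mathcomp Require Import ring lra.
From mathcomp Require Import boolp classical_sets reals ereal numfun.
From mathcomp Require Import topology normedtype derive.
From mathcomp Require Import fraction.
From mathcomp Require Import -(notations) mpoly.
Import Order.TTheory GRing.Theory Num.Theory numFieldNormedType.Exports.
Local Open Scope ring_scope.
Set Implicit Arguments.
Unset Strict Implicit.
Unset Printing Implicit Defensive.

(** Identify the dual volume of [P] with a value of an additive functional on
cones of R^(1+d). The epigraph of the support function,
[epi P = {(s, v) | forall y in P, 0 <= s + <v, y>}], is, off finitely many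
hyperplanes, the disjoint union of the simplicial cones spanned by [(1, 0)] and
the [(h_P(v_j), v_j)], for [v_1, ..., v_d] running through a triangulation of
the normal fan; at [w = (1, z)] the function
[sigma_w(V) = |det V| / prod_j <V_j, w>] of these cones sums to the dual volume.

Two facts then suffice. First, [sum_i alpha_i [P_i] = 0] implies
[sum_i alpha_i [epi P_i] = 0], because the Euler characteristic is additive on
closed convex sets and [(s, v)] lies outside [epi P] exactly when [P] meets
[{<v, y> < - s}]. Second, [sigma_w] respects generic linear relations between
simplicial cones; relations that hold only up to a function invariant along
some [u] with [<u, w> <> 0] are respected as well, which kills the flat
polyhedra. The second fact goes by induction on the dimension: along generic
lines parallel to [u], the jumps of the indicator functions on a fixed
hyperplane give a relation between facets lying in that hyperplane, and [sigma_w]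
of a cone is a signed combination of the [sigma] of its facets.

Triangulations of normal fans without new rays come from perturbing the right
hand sides of an irredundant system [a_i y <= b_i] to [b_i + t^(i+1)], which
makes the polyhedron simple. *)

(** * Generic points *)

Section Generic.
Context {R : realType}.

(** Off finitely many linear hyperplanes. In dimension 0 every vector is 0, so the list is empty and
    the property holds everywhere. *)
Definition generically n (Q : 'rV[R]_n -> Prop) : Prop :=
  exists2 s : seq 'rV[R]_n, 0 \notin s &
    forall x, (forall v, v \in s -> dot v x != 0) -> Q x.

Lemma genericallyT n (Q : 'rV[R]_n -> Prop) : (forall x, Q x) -> generically Q.
Proof. by move=> HQ; exists [::]. Qed.

Lemma generically_imp n (Q Q' : 'rV[R]_n -> Prop) :
  (forall x, Q x -> Q' x) -> generically Q -> generically Q'.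
Proof. by move=> QQ' [s s0 HQ]; exists s => // x /HQ/QQ'. Qed.

Lemma generically_and n (Q Q' : 'rV[R]_n -> Prop) :
  generically Q -> generically Q' -> generically (fun x => Q x /\ Q' x).
Proof.
move=> [s s0 HQ] [s' s'0 HQ']; exists (s ++ s').
  by rewrite mem_cat negb_or s0.
by move=> x Hx; split; [apply: HQ | apply: HQ'] => v vs; apply: Hx;
  rewrite mem_cat vs ?orbT.
Qed.

Lemma generically_seq n (T : eqType) (Q : T -> 'rV[R]_n -> Prop) (r : seq T) :
  (forall i, i \in r -> generically (Q i)) ->
  generically (fun x => forall i, i \in r -> Q i x).
Proof.
elim: r => [|i r IH] H; first exact: genericallyT.
have Hi := H i (mem_head _ _).
have {}IH := IH (fun j jr => H j (mem_behead (s := i :: r) jr)).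
apply: generically_imp (generically_and Hi IH) => x [Qi Qr] j.
by rewrite inE => /predU1P[->|/Qr].
Qed.

Lemma generically_fin n (I : finType) (Q : I -> 'rV[R]_n -> Prop) :
  (forall i, generically (Q i)) -> generically (fun x => forall i, Q i x).
Proof.
move=> H; have := @generically_seq n I Q (index_enum I) (fun i _ => H i).
by apply: generically_imp => x Hx i; apply: Hx; rewrite mem_index_enum.
Qed.

Lemma generically_neq n (v : 'rV[R]_n) :
  v != 0 -> generically (fun x => dot v x != 0).
Proof.
move=> v0; exists [:: v]; first by rewrite inE eq_sym.
by move=> x; apply; rewrite inE.
Qed.

Lemma dotE n (v x : 'rV[R]_n) : dot v x = (v *m x^T) 0 0.
Proof. by rewrite /dot mxE; apply: eq_bigr => j _; rewrite mxE. Qed.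

Lemma dot_mulmx n m (v : 'rV[R]_n) (x : 'rV[R]_m) (A : 'M[R]_(m, n)) :
  dot v (x *m A) = dot (v *m A^T) x.
Proof. by rewrite !dotE trmx_mul mulmxA. Qed.

Lemma dotC n (v x : 'rV[R]_n) : dot v x = dot x v.
Proof. by apply: eq_bigr => j _; rewrite mulrC. Qed.

Lemma dotDl n (x y z : 'rV[R]_n) : dot (x + y) z = dot x z + dot y z.
Proof. by rewrite !dotE mulmxDl mxE. Qed.

Lemma dotZl n a (x y : 'rV[R]_n) : dot (a *: x) y = a * dot x y.
Proof. by rewrite !dotE -scalemxAl mxE. Qed.

Lemma dotNl n (x y : 'rV[R]_n) : dot (- x) y = - dot x y.
Proof. by rewrite -scaleN1r dotZl mulN1r. Qed.

Lemma dotDr n (x y z : 'rV[R]_n) : dot x (y + z) = dot x y + dot x z.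
Proof. by rewrite dotC dotDl !(dotC x). Qed.

Lemma dotZr n a (x y : 'rV[R]_n) : dot x (a *: y) = a * dot x y.
Proof. by rewrite dotC dotZl dotC. Qed.

Lemma dotNr n (x y : 'rV[R]_n) : dot x (- y) = - dot x y.
Proof. by rewrite dotC dotNl dotC. Qed.

Lemma dotBr n (x y z : 'rV[R]_n) : dot x (y - z) = dot x y - dot x z.
Proof. by rewrite dotDr dotNr. Qed.

Lemma dot0l n (x : 'rV[R]_n) : dot 0 x = 0.
Proof. by rewrite dotE mul0mx mxE. Qed.

Lemma dot0r n (x : 'rV[R]_n) : dot x 0 = 0.
Proof. by rewrite dotC dot0l. Qed.

Lemma dot_suml n (I : Type) (r : seq I) (P : pred I) (F : I -> 'rV[R]_n) y :
  dot (\sum_(i <- r | P i) F i) y = \sum_(i <- r | P i) dot (F i) y.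
Proof.
by apply: (big_morph (fun x => dot x y)) => [a b|]; rewrite ?dotDl ?dot0l.
Qed.

Lemma dot_ge0 n (x : 'rV[R]_n) : 0 <= dot x x.
Proof. by apply: sumr_ge0 => j _; rewrite -expr2 sqr_ge0. Qed.

Lemma dot_eq0 n (x : 'rV[R]_n) : (dot x x == 0) = (x == 0).
Proof.
apply/idP/eqP => [|->]; last by rewrite dot0l.
rewrite psumr_eq0 => [/allP H|j _]; last by rewrite -expr2 sqr_ge0.
apply/rowP => j; rewrite mxE; apply/eqP.
by have := H j (mem_index_enum j); rewrite mulf_eq0 orbb.
Qed.

Lemma dot_gt0 n (x : 'rV[R]_n) : x != 0 -> 0 < dot x x.
Proof. by move=> x0; rewrite lt0r dot_eq0 x0 dot_ge0. Qed.

Lemma generically_mulmx n (Q : 'rV[R]_n -> Prop) (A : 'M[R]_n) :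
  A \in unitmx -> generically Q -> generically (fun x => Q (x *m A)).
Proof.
move=> Au [s s0 HQ]; exists [seq v *m A^T | v <- s].
  apply/mapP => -[v vs /esym/(congr1 (mulmxr (invmx A^T)))].
  rewrite /= mulmxK ?unitmx_tr// mul0mx => v0.
  by move: s0; rewrite -v0 vs.
move=> x Hx; apply: HQ => v vs.
by rewrite dot_mulmx; apply: Hx; apply: map_f.
Qed.

(** A finite set leaves some interval [[t, tau)] free, so evaluation at [t] replaces a limit from
    the left. *)
Lemma gap_below (s : seq R) (tau : R) :
  exists2 t, t < tau & forall x, x \in s -> t <= x -> tau <= x.
Proof.
elim: s => [|y s [t ttau IH]]; first by exists (tau - 1); rewrite ?gtrBl.
have [ytau|tauy] := ltP y tau; last first.
  by exists t => // x; rewrite inE => /predU1P[->|/IH].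
exists (Num.max t ((y + tau) / 2)).
  by rewrite gt_max ttau /=; lra.
move=> x; rewrite inE ge_max => /predU1P[->|/IH H /andP[/H//]].
by move=> /andP[_ ?]; lra.
Qed.

Lemma gap_above (s : seq R) (tau : R) :
  exists2 t, tau < t & forall x, x \in s -> x <= t -> x <= tau.
Proof.
have [t tt H] := gap_below (map -%R s) (- tau).
exists (- t); first by rewrite ltrNr.
by move=> x xs xt; rewrite -lerN2 H ?map_f// lerNr.
Qed.

Lemma sum_group0 (V : zmodType) (I : finType) (T : eqType) (key : I -> T)
    (P : pred I) (F : I -> V) :
  (forall q, \sum_(i | P i && (key i == q)) F i = 0) -> \sum_(i | P i) F i = 0.
Proof.
move=> H; have key_in i : key i \in undup (map key (index_enum I)).
  by rewrite mem_undup map_f// mem_index_enum.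
transitivity (\sum_(q <- undup (map key (index_enum I)))
                \sum_(i | P i) (if key i == q then F i else 0)).
  rewrite exchange_big /=; apply: eq_bigr => i _.
  rewrite (bigD1_seq (key i)) ?undup_uniq//= eqxx big1 ?addr0// => q /negPf.
  by rewrite eq_sym => ->.
by rewrite big1// => q _; rewrite -big_mkcondr H.
Qed.

End Generic.

(** * Generic relations between simplicial cones *)

Section Cones.
Context {R : realType}.

Definition incone n (V : 'M[R]_n) (x : 'rV[R]_n) : bool :=
  [forall j, 0 <= (x *m invmx V) 0 j].

Lemma cone_ofP n (V : 'M[R]_n) x :
  V \in unitmx -> cone_of V x <-> incone V x.
Proof.
move=> Vu; split => [[c [c0 ->]]|/forallP H].
  by apply/forallP => j; rewrite mulmxK.
by exists (x *m invmx V); split => //; rewrite mulmxKV.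
Qed.

(** The added coordinate comes first: it is the fibre direction in the induction on the dimension,
    and the coordinate [s] of epigraphs. *)
Definition pt n (t : R) (x : 'rV[R]_n) : 'rV[R]_n.+1 :=
  \row_j oapp (x 0) t (unlift ord0 j).

Lemma pt0 n t (x : 'rV[R]_n) : pt t x 0 ord0 = t.
Proof. by rewrite mxE unlift_none. Qed.

Lemma ptS n t (x : 'rV[R]_n) j : pt t x 0 (lift ord0 j) = x 0 j.
Proof. by rewrite mxE liftK. Qed.

Lemma pt_shift n t t' (x : 'rV[R]_n) :
  pt t x = pt t' x + (t - t') *: delta_mx 0 ord0.
Proof.
apply/rowP => j; rewrite !mxE.
case: unliftP => [k ->|->]; last by rewrite !eqxx /= mulr1; ring.
by rewrite (eq_sym (lift _ _)) (negPf (neq_lift _ _)) andbF mulr0 addr0.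
Qed.

Lemma dot_pt n s t (x y : 'rV[R]_n) : dot (pt s x) (pt t y) = s * t + dot x y.
Proof.
by rewrite /dot big_ord_recl !pt0; congr +%R; apply: eq_bigr => j _; rewrite !ptS.
Qed.

Lemma pt_surj n (x : 'rV[R]_n.+1) : x = pt (x 0 ord0) (\row_j x 0 (lift ord0 j)).
Proof.
apply/rowP => j; case: (unliftP ord0 j) => [k ->|->]; last by rewrite pt0.
by rewrite ptS mxE.
Qed.

Lemma pt_eq0 n t (x : 'rV[R]_n) : (pt t x == 0) = (t == 0) && (x == 0).
Proof.
apply/eqP/andP => [/rowP H|[/eqP-> /eqP->]].
  split; apply/eqP; first by have := H ord0; rewrite pt0 mxE.
  by apply/rowP => j; have := H (lift ord0 j); rewrite ptS !mxE.
by apply/rowP => j; rewrite !mxE; case: unliftP => //= k _; rewrite mxE.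
Qed.

Section Minor.
Variables (n : nat) (V : 'M[R]_n.+1).
Implicit Types (x : 'rV[R]_n) (k : 'I_n.+1).

(* The facet opposite to the [k]-th generator spans the hyperplane of the points
   [pt (x *m slope k) x], unless [coef k = 0], when it is parallel to the fibres. *)
Definition minor k : 'M[R]_n := row' k (col' ord0 V).
Definition slope k : 'cV[R]_n :=
  invmx (minor k) *m \col_j V (lift k j) ord0.
Definition coef k : R := invmx V ord0 k.

Hypothesis Vu : V \in unitmx.

(** Cramer's rule: up to sign, [coef k] is this minor divided by the determinant. *)
Lemma det_minor k : `|\det (minor k)| = `|coef k| * `|\det V|.
Proof.
have dV : \det V != 0 by rewrite -unitfE -unitmxE.
rewrite -normrM /coef /invmx Vu !mxE mulrC mulrA divff// mul1r /cofactor.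
by rewrite normrM normrX normrN1 expr1n mul1r.
Qed.

Lemma minor_unit k : (minor k \in unitmx) = (coef k != 0).
Proof.
rewrite unitmxE unitfE -normr_gt0 det_minor pmulr_lgt0 ?normr_gt0//.
by rewrite -unitfE -unitmxE.
Qed.

Lemma minor_slope k j : coef k != 0 ->
  V (lift k j) ord0 = \sum_l V (lift k j) (lift ord0 l) * slope k l 0.
Proof.
rewrite -minor_unit => mu.
have /colP/(_ j) : minor k *m slope k = \col_j V (lift k j) ord0.
  by rewrite /slope mulKVmx.
by rewrite !mxE => <-; apply: eq_bigr => l _; rewrite !mxE.
Qed.

(** Every row of [V] belongs to one of two distinct facets; if these spanned the same hyperplane,
    all rows would lie in it. *)
Lemma slope_inj k k' : coef k != 0 -> coef k' != 0 ->
  slope k = slope k' -> k = k'.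
Proof.
move=> ck ck' eq_s; apply/eqP/negPn/negP => kk'.
(* A normal vector of the common hyperplane. *)
pose c : 'cV[R]_n.+1 := \col_j oapp (fun l => slope k l 0) (-1) (unlift ord0 j).
have Vc : V *m c = 0.
  apply/colP => i; rewrite !mxE big_ord_recl !mxE unlift_none /= mulrN1.
  under eq_bigr do rewrite mxE liftK /=.
  apply/eqP; rewrite addrC subr_eq0 eq_sym; apply/eqP.
  case: (unliftP k i) => [j ->|ik]; first exact: minor_slope.
  case: (unliftP k' i) => [j ->|ik']; first by rewrite eq_s; apply: minor_slope.
  by move: kk'; rewrite -ik -ik' eqxx.
have /colP/(_ ord0) : c = 0 by rewrite -[c](mulKmx Vu) Vc mulmx0.
by rewrite !mxE unlift_none /= => /eqP; rewrite oppr_eq0 oner_eq0.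
Qed.

(** The point is a combination of the generators other than the [k]-th, and [x] alone determines the
    coefficients. Hence it lies in the facet exactly when [x] lies in the cone of [minor k]. *)
Lemma on_face k x : coef k != 0 ->
  pt ((x *m slope k) 0 0) x *m invmx V
  = \row_j oapp ((x *m invmx (minor k)) 0) 0 (unlift k j).
Proof.
move=> ck; have mu : minor k \in unitmx by rewrite minor_unit.
set mu_ := x *m invmx (minor k); set lam := \row_j _.
suff -> : pt ((x *m slope k) 0 0) x = lam *m V by rewrite mulmxK.
have lamV j : (lam *m V) 0 j = \sum_l mu_ 0 l * V (lift k l) j.
  rewrite mxE (bigD1_ord k)//= mxE unlift_none /= mul0r add0r.
  by apply: eq_bigr => l _; rewrite mxE liftK.
apply/rowP => j; rewrite lamV; case: (unliftP ord0 j) => [l ->|->].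
  rewrite ptS -[in LHS](mulmxKV mu x) mxE.
  by apply: eq_bigr => i _; rewrite !mxE.
rewrite pt0 /slope mulmxA mxE.
by apply: eq_bigr => i _; rewrite !mxE.
Qed.

Lemma coord_shift t t' x j :
  (pt t x *m invmx V) 0 j = (pt t' x *m invmx V) 0 j + (t - t') * coef j.
Proof. by rewrite (pt_shift t t') mulmxDl -scalemxAl -rowE !mxE. Qed.

Lemma coord_root t x j : coef j != 0 ->
  (pt t x *m invmx V) 0 j = (t - (x *m slope j) 0 0) * coef j.
Proof.
move=> cj; rewrite (coord_shift t ((x *m slope j) 0 0)) on_face//.
by rewrite mxE unlift_none /= add0r.
Qed.

(* Moving upwards along the fibre over [x], one enters the cone through facets
   with [coef k > 0] and leaves it through facets with [coef k < 0]. *)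
Lemma crossing (q : 'cV[R]_n) x t1 t2 :
  t1 < (x *m q) 0 0 < t2 ->
  (forall k, coef k != 0 -> slope k != q ->
     ~~ (t1 <= (x *m slope k) 0 0 <= t2)) ->
  (incone V (pt t2 x))%:R - (incone V (pt t1 x))%:R
  = \sum_(k | (coef k != 0) && (slope k == q))
      Num.sg (coef k) * (incone (minor k) x)%:R :> R.
Proof.
set tau := (x *m q) 0 0 => /andP[t1tau taut2] gap.
(* Along the fibre a coordinate is affine in [t]; it keeps its sign on the interval if it is
   constant or has its root outside. *)
have same j t : ~~ ((coef j != 0) && (slope j == q)) -> t1 <= t <= t2 ->
    (0 <= (pt t x *m invmx V) 0 j) = (0 <= (pt tau x *m invmx V) 0 j).
  rewrite negb_and negbK => /orP[/eqP cj|sj] tt.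
    by rewrite (coord_shift t tau) cj mulr0 addr0.
  have [cj|cj] := eqVneq (coef j) 0.
    by rewrite (coord_shift t tau) cj mulr0 addr0.
  rewrite !coord_root//; have := gap _ cj sj; set tj := (x *m slope j) 0 0.
  have [tjt1 _|t1tj /=] := ltP tj t1.
    by rewrite !pmulr_rge0// subr_gt0; lra.
  rewrite -ltNge => t2tj; rewrite !nmulr_rge0// subr_lt0; lra.
(* By [slope_inj], at most one facet lies in the hyperplane of slope [q]. *)
case: (pickP (fun k => (coef k != 0) && (slope k == q))) => [k kP|none].
  have /andP[ck /eqP sk] := kP.
  rewrite (big_pred1 k); last first.
    move=> j /=; apply/andP/eqP => [[cj /eqP sj]|->]; last by rewrite ck sk.
    by apply: slope_inj => //; rewrite sj sk.
  have other j : j != k -> ~~ ((coef j != 0) && (slope j == q)).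
    apply: contra => /andP[cj /eqP sj]; apply/eqP.
    by apply: slope_inj => //; rewrite sj sk.
  have face : incone (minor k) x =
      [forall j, (j != k) ==> (0 <= (pt tau x *m invmx V) 0 j)].
    rewrite /tau -sk on_face//; apply/forallP/forallP => H j.
      apply/implyP; rewrite mxE; case: unliftP => [l _ _|->]; last by rewrite eqxx.
      exact: H.
    by have := H (lift k j); rewrite eq_sym neq_lift mxE liftK.
  have cone_t t : t1 <= t <= t2 ->
      incone V (pt t x) = (0 <= (t - tau) * coef k) && incone (minor k) x.
    move=> tt; rewrite face /incone /tau -sk -coord_root//.
    apply/forallP/andP => [H|[Hk /forallP H] j].
      split=> //; apply/forallP => j; apply/implyP => jk.
      by have := H j; rewrite (same _ _ (other _ jk) tt) /tau sk.
    have [->//|jk] := eqVneq j k.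
    by rewrite (same _ _ (other _ jk) tt); have := H j; rewrite jk /tau sk.
  rewrite !cone_t; try lra.
  have tau2 : 0 < t2 - tau by rewrite subr_gt0.
  have tau1 : t1 - tau < 0 by rewrite subr_lt0.
  rewrite (pmulr_rge0 _ tau2) (nmulr_rge0 _ tau1).
  case: (incone _ _); rewrite ?andbT ?andbF ?mulr1 ?mulr0 ?subr0//.
  by case: (sgrP (coef k)) ck => //= _ _; rewrite ?subr0 ?sub0r.
rewrite big_pred0//; apply/eqP; rewrite subr_eq0; apply/eqP; congr (_ %:R).
congr (nat_of_bool _); apply: eq_forallb => j.
by rewrite !same ?none// ?lexx ?(ltW (lt_trans t1tau taut2)).
Qed.

End Minor.
End Cones.

(** * The functional [sigma] and its additivity *)

Section Sigma.
Context {R : realType} {K : fieldType} (phi : {rmorphism R -> K}).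

Definition pairing n (w : 'cV[K]_n) (v : 'rV[R]_n) : K :=
  (map_mx phi v *m w) 0 0.

(** For real [w] with positive pairings this is the integral of exp(-<x, w>) over the cone spanned
    by the rows of [V]. *)
Definition sigma n (w : 'cV[K]_n) (V : 'M[R]_n) : K :=
  phi `|\det V| / \prod_j pairing w (row j V).

Definition fibrewise n (G : 'rV[R]_n -> R) (u : 'rV[R]_n) : Prop :=
  forall t x, G (x + t *: u) = G x.

Definition sigma_additive n : Prop :=
  forall (I : finType) (P : pred I) (c : I -> R) (V : I -> 'M[R]_n)
    (w : 'cV[K]_n),
  (forall i, P i -> V i \in unitmx) ->
  (forall i j, P i -> pairing w (row j (V i)) != 0) ->
  generically (fun x => \sum_(i | P i) c i * (incone (V i) x)%:R = 0) ->
  \sum_(i | P i) phi (c i) * sigma w (V i) = 0.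

(** The first basis vector is the sum of [coef V k] times the [k]-th generator. Pairing it with [w]
    writes [w ord0 0] as a sum whose [k]-th term cancels one factor of the denominator, and
    [det_minor] converts the determinant. *)
Lemma sigma_faces n (w : 'cV[K]_n.+1) (V : 'M[R]_n.+1) : V \in unitmx ->
  (forall j, pairing w (row j V) != 0) ->
  w ord0 0 * sigma w V =
  \sum_(k | coef V k != 0) phi (Num.sg (coef V k)) *
    (phi `|\det (minor V k)| / \prod_j pairing w (row (lift k j) V)).
Proof.
move=> Vu pw; have pw0 : \prod_j pairing w (row j V) != 0.
  by rewrite prodf_seq_neq0; apply/allP => j _; rewrite pw.
have w0E : w ord0 0 = \sum_k phi (coef V k) * pairing w (row k V).
  transitivity ((map_mx phi (invmx V *m V) *m w) ord0 0).
    by rewrite mulVmx// map_mx1 mul1mx.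
  rewrite map_mxM -mulmxA mxE; apply: eq_bigr => k _.
  by rewrite [in LHS]mxE /pairing map_row -row_mul !mxE.
rewrite w0E mulr_suml [RHS]big_mkcond /=; apply: eq_bigr => k _.
have [->|ck] /= := eqVneq (coef V k) 0; first by rewrite rmorph0 !mul0r.
rewrite det_minor// mulrA -rmorphM [Num.sg _ * _]mulrA -numEsg rmorphM /sigma.
move: pw0; rewrite (bigD1_ord k)//= mulf_eq0 negb_or => /andP[pk pk'].
by field; rewrite pk pk'.
Qed.

(** After multiplication by [w ord0 0], [sigma_faces] turns the sum into one over facets. These are
    grouped by the hyperplane they span, and the induction hypothesis applies to each group. *)
Lemma sigma_fibrewise_std n : sigma_additive n ->
  forall (I : finType) (P : pred I) (c : I -> R) (V : I -> 'M[R]_n.+1)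
    (w : 'cV[K]_n.+1) (G : 'rV[R]_n.+1 -> R),
  (forall i, P i -> V i \in unitmx) ->
  (forall i j, P i -> pairing w (row j (V i)) != 0) ->
  w ord0 0 != 0 -> fibrewise G (delta_mx 0 ord0) ->
  generically (fun x => \sum_(i | P i) c i * (incone (V i) x)%:R = G x) ->
  \sum_(i | P i) phi (c i) * sigma w (V i) = 0.
Proof.
move=> IH I P c V w G Vu pw w0 Ginv [s s0 HG].
apply: (mulfI w0); rewrite mulr0 mulr_sumr.
pose Q (p : I * 'I_n.+1) := P p.1 && (coef (V p.1) p.2 != 0).
transitivity (\sum_(p | Q p) phi (c p.1 * Num.sg (coef (V p.1) p.2)) *
    (phi `|\det (minor (V p.1) p.2)| /
     \prod_j pairing w (row (lift p.2 j) (V p.1)))).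
  rewrite [RHS](eq_bigl (fun p => P p.1 && Q p)); last first.
    by move=> p; rewrite /Q andbA andbb.
  rewrite -(pair_big_dep P (fun i k => Q (i, k)) (fun i k =>
    phi (c i * Num.sg (coef (V i) k)) *
    (phi `|\det (minor (V i) k)| / \prod_j pairing w (row (lift k j) (V i))))) /=.
  apply: eq_bigr => i Pi; rewrite mulrCA sigma_faces//; last by move=> j; exact: pw.
  2: exact: Vu.
  rewrite mulr_sumr; apply: eq_big => [k|k _]; first by rewrite /Q Pi.
  by rewrite rmorphM -mulrA.
apply: (@sum_group0 _ _ _ (fun p : I * 'I_n.+1 => slope (V p.1) p.2)) => q.
(* The pullback of [w] along the parametrization of the hyperplane of slope [q] by [x]. *)
pose w' : 'cV[K]_n := \col_l (w (lift ord0 l) 0 + phi (q l 0) * w ord0 0).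
have pairE p j : Q p && (slope (V p.1) p.2 == q) ->
    pairing w' (row j (minor (V p.1) p.2)) = pairing w (row (lift p.2 j) (V p.1)).
  move=> /andP[/andP[Pp cp] /eqP sq].
  rewrite /pairing !mxE big_ord_recl !mxE (minor_slope (Vu _ Pp) _ cp).
  rewrite rmorph_sum mulr_suml -big_split /=; apply: eq_bigr => l _.
  by rewrite sq rmorphM !mxE; ring.
transitivity (\sum_(p | Q p && (slope (V p.1) p.2 == q))
    phi (c p.1 * Num.sg (coef (V p.1) p.2)) * sigma w' (minor (V p.1) p.2)).
  apply: eq_bigr => p Hp; rewrite /sigma; congr (_ * (_ / _)).
  by apply: eq_bigr => j _; rewrite pairE.
apply: IH.
- by move=> p /andP[/andP[Pp cp] _]; rewrite minor_unit// Vu.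
- by move=> p j Hp; rewrite pairE//; apply: pw; case/andP: Hp => /andP[].
(* Exceptional hyperplanes parallel to the fibres can only be avoided by the choice of [x]; the
   others are avoided by the choice of the height. *)
pose tl (v : 'rV[R]_n.+1) : 'rV[R]_n := \row_j v 0 (lift ord0 j).
have g1 : generically (fun x => forall v, v \in s -> tl v != 0 -> dot (tl v) x != 0).
  apply: generically_seq => v _; have [->|v0] := eqVneq (tl v) 0.
    by apply: genericallyT => x; rewrite ?eqxx.
  by apply: generically_imp (generically_neq v0) => x.
(* Facet hyperplanes of another slope do not meet the fibre at the height [tau] where the hyperplane
   of slope [q] does. *)
have g2 : generically (fun x : 'rV[R]_n => forall p : I * 'I_n.+1,
    slope (V p.1) p.2 != q -> (x *m slope (V p.1) p.2) 0 0 != (x *m q) 0 0).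
  apply: generically_fin => p; have [->|sq] := eqVneq (slope (V p.1) p.2) q.
    by apply: genericallyT => x; rewrite ?eqxx.
  have sq' : (slope (V p.1) p.2 - q)^T != 0 by rewrite trmx_eq0 subr_eq0.
  apply: generically_imp (generically_neq sq') => x Hx _; move: Hx.
  rewrite dotC dotE trmxK mulmxBr; apply: contra => /eqP E.
  by rewrite !mxE in E *; rewrite E subrr.
apply: generically_imp (generically_and g1 g2) => x [Hs Hq] {g1 g2}.
set tau := (x *m q) 0 0.
(* The heights at which the fibre over [x] meets an exceptional hyperplane or a facet hyperplane. *)
pose L := [seq - dot (tl v) x / v 0 ord0 | v <- s] ++
   [seq (x *m slope (V p.1) p.2) 0 0 | p <- index_enum (I * 'I_n.+1)%type].
have [t1 t1tau H1] := gap_below L tau.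
have [t2 taut2 H2] := gap_above L tau.
have gen_t t : t \notin L -> forall v, v \in s -> dot v (pt t x) != 0.
  move=> tL v vs; rewrite (pt_surj v) dot_pt -/(tl v).
  have [v0|v0] := eqVneq (v 0 ord0) 0.
    rewrite v0 mul0r add0r; apply: Hs => //; apply/negP => /eqP tv0.
    move: s0; rewrite (_ : 0 = v) ?vs//.
    by apply/esym/eqP; rewrite (pt_surj v) pt_eq0 v0 eqxx -/(tl v) tv0 eqxx.
  apply: contra tL => /eqP tE; rewrite mem_cat; apply/orP; left.
  by apply/mapP; exists v => //; apply: (mulIf v0); rewrite divfK//; lra.
have t1L : t1 \notin L by apply/negP => /H1/(_ (lexx _)); rewrite leNgt t1tau.
have t2L : t2 \notin L by apply/negP => /H2/(_ (lexx _)); rewrite leNgt taut2.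
(* The two heights lie on one fibre, so [G] drops out of the difference and only the jumps at [tau]
   remain. *)
have GG : G (pt t2 x) = G (pt t1 x) by rewrite (pt_shift t2 t1) Ginv.
have := HG _ (gen_t _ t2L); rewrite GG -(HG _ (gen_t _ t1L)) => /eqP.
rewrite -subr_eq0 -sumrB => /eqP eq0; rewrite -[RHS]eq0.
rewrite (eq_bigl (fun p => P p.1 && (Q p && (slope (V p.1) p.2 == q)))); last first.
  by move=> p; rewrite /Q -!andbA; case: (P _).
rewrite -(pair_big_dep P (fun i k => Q (i, k) && (slope (V i) k == q))
  (fun i k => c i * Num.sg (coef (V i) k) * (incone (minor (V i) k) x)%:R)) /=.
apply: eq_bigr => i Pi; rewrite -mulrBr (crossing (Vu i Pi) (q := q)).
- rewrite mulr_sumr; apply: eq_big => [k|k _]; first by rewrite /Q Pi.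
  by rewrite mulrA.
- by rewrite t1tau.
move=> k ck sk; apply/negP => /andP[k1 k2].
have kL : (x *m slope (V i) k) 0 0 \in L.
  rewrite mem_cat; apply/orP; right; apply/mapP.
  by exists (i, k) => //; rewrite mem_index_enum.
by move: (Hq (i, k) sk) => /= /negP; apply; rewrite eq_le H1// H2.
Qed.

Lemma sigma_mulmx n (w : 'cV[K]_n) (V A : 'M[R]_n) : A \in unitmx ->
  sigma (map_mx phi A *m w) (V *m invmx A) = sigma w V / phi `|\det A|.
Proof.
move=> Au; have dA : phi `|\det A| != 0.
  by rewrite fmorph_eq0 normr_eq0 -unitfE -unitmxE.
rewrite /sigma det_mulmx det_inv normrM normfV rmorphM fmorphV mulrAC.
congr (_ / _ / _); apply: eq_bigr => j _.
by rewrite /pairing mulmxA -map_mxM row_mul mulmxKV.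
Qed.

(** A linear change of coordinates carries the first basis vector to [u]; it multiplies every
    [sigma] by the same nonzero constant. *)
Lemma sigma_fibrewise n : sigma_additive n ->
  forall (I : finType) (P : pred I) (c : I -> R) (V : I -> 'M[R]_n.+1)
    (w : 'cV[K]_n.+1) (G : 'rV[R]_n.+1 -> R) (u : 'rV[R]_n.+1),
  (forall i, P i -> V i \in unitmx) ->
  (forall i j, P i -> pairing w (row j (V i)) != 0) ->
  pairing w u != 0 -> fibrewise G u ->
  generically (fun x => \sum_(i | P i) c i * (incone (V i) x)%:R = G x) ->
  \sum_(i | P i) phi (c i) * sigma w (V i) = 0.
Proof.
move=> IH I P c V w G u Vu pw pu Ginv HG.
have u0 : u != 0.
  by apply: contraNneq pu => ->; rewrite /pairing map_mx0 mul0mx mxE.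
have [A Au uE] : exists2 A : 'M[R]_n.+1, A \in unitmx &
    u = delta_mx 0 ord0 *m A.
  pose f : 'M[R]_n.+1 := delta_mx ord0 0 *m u.
  have fE : (delta_mx 0 ord0 : 'rV[R]_n.+1) *m f = u.
    by rewrite /f mulmxA mul_delta_mx -rowE; apply/rowP => j; rewrite mxE.
  have [|A Au AE] := @complete_unitmx _ _ _ (delta_mx 0 ord0 : 'rV[R]_n.+1) f.
    by rewrite fE rank_rV u0 mxrank_delta.
  by exists A; rewrite // -AE fE.
have dA : phi `|\det A| != 0.
  by rewrite fmorph_eq0 normr_eq0 -unitfE -unitmxE.
have : \sum_(i | P i) phi (c i) * sigma (map_mx phi A *m w) (V i *m invmx A) = 0.
  apply: (sigma_fibrewise_std IH (G := fun x => G (x *m A))).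
  - by move=> i Pi; rewrite unitmx_mul Vu//= unitmx_inv.
  - move=> i j Pi; rewrite /pairing mulmxA -map_mxM row_mul mulmxKV//.
    exact: pw.
  - by move: pu; rewrite uE /pairing map_mxM -mulmxA map_delta_mx -rowE mxE.
  - by move=> t x; rewrite mulmxDl -scalemxAl -uE Ginv.
  apply: generically_imp (generically_mulmx Au HG) => x <-.
  apply: eq_bigr => i Pi; congr (_ * (nat_of_bool _)%:R).
  suff E : x *m invmx (V i *m invmx A) = x *m A *m invmx (V i).
    by rewrite /incone E.
  have VAu : V i *m invmx A \in unitmx by rewrite unitmx_mul Vu//= unitmx_inv.
  apply: (can_inj (mulmxK VAu)); rewrite mulmxKV// mulmxA mulmxKV ?Vu//.
  by rewrite mulmxK.
under eq_bigr do rewrite sigma_mulmx// mulrA.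
by rewrite -mulr_suml => /eqP; rewrite mulf_eq0 invr_eq0 (negPf dA) orbF => /eqP.
Qed.

(** In dimension 0 every cone is the origin and every [sigma] is 1. In the step [G] is 0, and any
    generator of one of the cones serves as [u], its pairing being nonzero by hypothesis. *)
Lemma sigma_additiveT n : sigma_additive n.
Proof.
elim: n => [|n IH] I P c V w Vu pw HG.
  have H0 : \sum_(i | P i) c i * (incone (V i) 0)%:R = 0.
    case: HG => s s0; apply=> v; rewrite (_ : v = 0) ?(negPf s0)//.
    by apply/rowP => -[].
  rewrite (eq_bigr (fun i => phi (c i))) => [|i _]; last first.
    by rewrite /sigma det_mx00 normr1 rmorph1 big_ord0 divr1 mulr1.
  rewrite -rmorph_sum -[X in phi X](_ : \sum_(i | P i) c i * (incone (V i) 0)%:R = _).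
    by rewrite H0 rmorph0.
  apply: eq_bigr => i _; suff -> : incone (V i) 0 by rewrite mulr1.
  by apply/forallP => -[].
have [i Pi|P0] := pickP P; last by rewrite big_pred0.
by apply: (sigma_fibrewise IH (G := fun=> 0) (u := row ord0 (V i))) HG => //; apply: pw.
Qed.

End Sigma.

(** * The Euler relation and epigraphs *)

Section Euler.
Context {R : realType}.
Local Open Scope classical_set_scope.

Definition is_convex n (Q : set 'rV[R]_n) : Prop :=
  forall x y t, Q x -> Q y -> 0 <= t <= 1 -> Q (x + t *: (y - x)).

(** The segments are counted by their left endpoint [q]: those starting at [q] contain [q] but no
    point just below it, so their weight is a difference of two vanishing sums. *)
Lemma euler_segment (I : finType) (alpha : I -> R) (S : I -> set R) :
  (forall i, S i !=set0 -> exists a b, S i = [set s | a <= s <= b]) ->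
  (forall s, \sum_(i | `[< S i s >]) alpha i = 0) ->
  \sum_(i | `[< S i !=set0 >]) alpha i = 0.
Proof.
move=> HS sum0.
have /choice [f Hf] : forall i, exists f : R * R, S i !=set0 ->
    S i = [set s | f.1 <= s <= f.2].
  move=> i; have [/HS[a [b ->]]|none] := pselect (S i !=set0).
    by exists (a, b).
  by exists (0, 0).
have le12 i : S i !=set0 -> (f i).1 <= (f i).2.
  by move=> /[dup] ne; rewrite {1}(Hf i ne) => -[s /= /andP[]]; apply: le_trans.
apply: (sum_group0 (key := fun i => (f i).1)) => q.
(* No endpoint lies in [[t, q)], so a segment contains [t] exactly when it contains [q] and does not
   start there. *)
have [t tq gap] := gap_below
  ([seq (f i).1 | i <- enum I] ++ [seq (f i).2 | i <- enum I]) q.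
transitivity (\sum_(i | `[< S i q >]) alpha i - \sum_(i | `[< S i t >]) alpha i).
  2: by rewrite !sum0 subr0.
rewrite (bigID (fun i => (f i).1 == q) (fun i => `[< S i q >])) /=.
rewrite -[LHS]addr0 -addrA; congr +%R.
  apply: eq_bigl => i; apply/andP/andP => -[/asboolP Hi /eqP fq]; split.
  - by apply/asboolP; rewrite (Hf i Hi) /= fq lexx -fq le12.
  - exact/eqP.
  - by apply/asboolP; exists q.
  - exact/eqP.
apply/esym/eqP; rewrite subr_eq0; apply/eqP/eq_bigl => i.
apply/andP/asboolP => [[/asboolP Siq fq]|Sit].
  have ne : S i !=set0 by exists q.
  move: Siq; rewrite (Hf i ne) /= => /andP[f1 f2]; rewrite (le_trans (ltW tq))//.
  rewrite andbT leNgt; apply/negP => tf1; move: fq; rewrite eq_le f1/= gap ?(ltW tf1)//.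
  by rewrite mem_cat (map_f (fun i => (f i).1)) ?mem_enum.
have ne : S i !=set0 by exists t.
move: Sit; rewrite (Hf i ne) /= => /andP[f1 f2]; split; last first.
  by rewrite lt_eqF// (le_lt_trans f1).
apply/asboolP => /=; rewrite (le_trans f1 (ltW tq))/= gap//.
by rewrite mem_cat orbC (map_f (fun i => (f i).2)) ?mem_enum.
Qed.

Lemma closed_coord_eq n (x : 'rV[R]_n) (k : nat) :
  closed [set y : 'rV[R]_n | forall j : 'I_n, (k <= j)%N -> y 0 j = x 0 j].
Proof.
rewrite (_ : [set y | _] = \bigcap_(j in [set j : 'I_n | (k <= j)%N])
    ((fun y : 'rV[R]_n => y 0 j) @^-1` [set x 0 j])); last first.
  by apply/seteqP; split => y /= H j; apply: H.
apply: closed_bigI => j _; apply: closed_comp => [y _|]; last exact: closed_eq.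
exact: coord_continuous.
Qed.

(** Induction on the number [k] of free coordinates, from points at 0 to the whole sets at [n].
    Freeing one more coordinate projects compact convex slices to segments, to which [euler_segment]
    applies. *)
Lemma euler_slice n (I : finType) (alpha : I -> R) (Q : I -> set 'rV[R]_n) :
  (forall i, compact (Q i)) -> (forall i, is_convex (Q i)) ->
  (forall x, \sum_(i | `[< Q i x >]) alpha i = 0) ->
  forall k (x : 'rV[R]_n), (k <= n)%N ->
  \sum_(i | `[< exists2 y, Q i y & forall j : 'I_n, (k <= j)%N -> y 0 j = x 0 j >])
     alpha i = 0.
Proof.
move=> cQ vQ sum0; elim=> [|k IH] x kn.
  rewrite -[RHS](sum0 x); apply: eq_bigl => i; apply/asboolP/asboolP.
    by move=> [y Qy /(_ _ (leq0n _)) yx]; rewrite (_ : x = y)//; apply/rowP => j.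
  by exists x.
pose kk := Ordinal kn.
pose slice i := Q i `&`
  [set y : 'rV[R]_n | forall j : 'I_n, (k.+1 <= j)%N -> y 0 j = x 0 j].
pose S i := [set y 0 kk | y in slice i].
have csl i : compact (slice i) by apply: compact_closedI => //; exact: closed_coord_eq.
have vsl i : is_convex (slice i).
  move=> y z t [Qy yx] [Qz zx] t01; split; first exact: vQ.
  by move=> j kj; rewrite !mxE yx// zx// subrr mulr0 addr0.
transitivity (\sum_(i | `[< S i !=set0 >]) alpha i).
  apply: eq_bigl => i; apply/asboolP/asboolP => [[y Qy yx]|[s [y [Qy yx] _]]].
    by exists (y 0 kk); exists y.
  by exists y.
apply: euler_segment => [i [s [y0 Sy0 _]]|s].
  have ne : slice i !=set0 by exists y0.
  have cc : {within slice i, continuous (fun y : 'rV[R]_n => y 0 kk)}.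
    by apply: continuous_subspaceT => y; exact: coord_continuous.
  have [a /set_mem Sa amin] := compact_EVT_min ne (csl i) cc.
  have [b /set_mem Sb bmax] := compact_EVT_max ne (csl i) cc.
  exists (a 0 kk), (b 0 kk); apply/seteqP; split => [_ [y Sy <-]|t] /=.
    by rewrite amin ?bmax//; apply/mem_set.
  move=> /andP[at_ tb]; have [ab|ab] := eqVneq (a 0 kk) (b 0 kk).
    by exists a => //; apply/eqP; rewrite eq_le at_ ab tb.
  have ab' : 0 < b 0 kk - a 0 kk.
    by rewrite subr_gt0 lt_neqAle ab (le_trans at_).
  exists (a + ((t - a 0 kk) / (b 0 kk - a 0 kk)) *: (b - a)).
    apply: vsl => //; rewrite divr_ge0 ?subr_ge0 ?(ltW ab')//=.
      by rewrite ler_pdivrMr// mul1r lerB.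
    by move: ab'; rewrite subr_gt0 => /ltW.
  by rewrite !mxE divfK ?gt_eqF//; ring.
(* Prescribing the value [s] of coordinate [k] leaves a slice with only [k] free coordinates. *)
have := IH (\row_j if j == kk then s else x 0 j) (ltnW kn).
move=> H; rewrite -[RHS]H; apply: eq_bigl => i.
apply/asboolP/asboolP => [[y [Qy yx] ys]|[y Qy yx]].
  exists y => // j kj; rewrite mxE; case: eqVneq => [->//|jk].
  apply: yx; rewrite ltn_neqAle kj andbT eq_sym.
  by apply: contra jk => /eqP jk; apply/eqP/val_inj.
exists y; last by rewrite yx// mxE eqxx.
split=> // j kj; rewrite yx ?(ltnW kj)// mxE ifN//.
by apply/eqP => jk; move: kj; rewrite jk ltnn.
Qed.

Lemma dot_continuous n (a : 'rV[R]_n) : continuous (dot a).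
Proof.
apply: continuous_big => [|j _ y]; first exact: add_continuous.
by apply: continuousM; [exact: cst_continuous | exact: coord_continuous].
Qed.

Lemma closed_halfspace n (a : 'rV[R]_n) b : closed [set y | dot a y <= b].
Proof.
apply: (closed_comp (f := dot a) (D := [set s | s <= b])) => [y _|].
  exact: dot_continuous.
exact: closed_le.
Qed.

Lemma convex_halfspace n (a : 'rV[R]_n) b : is_convex [set y | dot a y <= b].
Proof. by move=> x y t /= ax ay /andP[t0 t1]; rewrite dotDr dotZr dotBr; nra. Qed.

Lemma convexI n (A B : set 'rV[R]_n) :
  is_convex A -> is_convex B -> is_convex (A `&` B).
Proof.
by move=> vA vB x y t [Ax Bx] [Ay By_] t01; split; [apply: vA|apply: vB].
Qed.

(** Intersecting with a box that holds a chosen point of each nonempty set makes the sets compact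
    without emptying any of them. *)
Lemma euler_relation n (I : finType) (alpha : I -> R) (Q : I -> set 'rV[R]_n) :
  (forall i, closed (Q i)) -> (forall i, is_convex (Q i)) ->
  (forall x, \sum_(i | `[< Q i x >]) alpha i = 0) ->
  \sum_(i | `[< Q i !=set0 >]) alpha i = 0.
Proof.
move=> cQ vQ sum0.
have /choice [y Hy] : forall i, exists y, Q i !=set0 -> Q i y.
  by move=> i; have [[y Qy]|] := pselect (Q i !=set0); [exists y|exists 0].
pose M := \sum_i \sum_j `|y i 0 j|.
have yM i j : - M <= y i 0 j <= M.
  rewrite -ler_norml /M (bigD1 i)//= (bigD1 j)//= -addrA lerDl.
  by rewrite addr_ge0// !sumr_ge0// => k _; rewrite sumr_ge0.
pose B := [set v : 'rV[R]_n | forall j, `[- M, M]%classic (v ord0 j)].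
have cB : compact B.
  by apply: (@rV_compact _ _ (fun=> `[- M, M]%classic)) => _; apply: segment_compact.
have vB : is_convex B.
  move=> u v t Bu Bv /andP[t0 t1] j; have := Bu j; have := Bv j.
  rewrite /= !in_itv /= !mxE => /andP[? ?] /andP[? ?]; apply/andP; nra.
have := @euler_slice n I alpha (fun i => B `&` Q i) _ _ _ n 0 (leqnn _).
move=> H; rewrite -[RHS]H; last 3 first.
- by move=> i; apply: compact_closedI.
- by move=> i; apply: convexI.
- move=> x; have [Bx|nBx] := pselect (B x).
    rewrite -[RHS](sum0 x); apply: eq_bigl => i.
    by apply/asboolP/asboolP => [[]|].
  by rewrite big1// => i /asboolP[].
apply: eq_bigl => i; apply/asboolP/asboolP => [ne|[x [Bx Qx] _]]; last by exists x.
exists (y i); last by move=> j; rewrite leqNgt ltn_ord.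
by split; [move=> j; rewrite /= in_itv /=; exact: yM | exact: Hy].
Qed.

Lemma indic_asbool T (A : set T) x : \1_A x = (`[< A x >])%:R :> R.
Proof. by rewrite indicE -[`[< A x >]]/(x \in A). Qed.

(** The dual cone of the homogenization of [P], the set of all (1, y) with y in [P]. *)
Definition epi n (P : set 'rV[R]_n) : set 'rV[R]_n.+1 :=
  [set x | forall y, P y -> 0 <= dot x (pt 1 y)].

Lemma epi_pt n (P : set 'rV[R]_n) s v :
  epi P (pt s v) <-> forall y, P y -> - dot v y <= s.
Proof.
by split=> H y /H; rewrite dot_pt mulr1 -lerBlDr sub0r.
Qed.

Lemma polyhedron_closed n (P : set 'rV[R]_n) : polyhedron P -> closed P.
Proof.
move=> [_ [m [a [b [_ ->]]]]].
rewrite (_ : [set y | _] = \bigcap_i [set y | dot (a i) y <= b i]).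
  by apply: closed_bigI => i _; exact: closed_halfspace.
by apply/seteqP; split => y /= H i; [move=> _|]; apply: H.
Qed.

Lemma polyhedron_convex n (P : set 'rV[R]_n) : polyhedron P -> is_convex P.
Proof.
move=> [_ [m [a [b [_ ->]]]]] x y t Hx Hy t01 i.
exact: (convex_halfspace (Hx i) (Hy i)).
Qed.

(** A point is outside the epigraph exactly when [P i] meets an open half-space. As [euler_relation]
    needs closed sets, the half-space is replaced by a closed one met by the same [P i]. *)
Lemma epi_relation n (I : finType) (alpha : I -> R) (P : I -> set 'rV[R]_n) :
  (forall i, polyhedron (P i)) ->
  (forall x, \sum_i alpha i * \1_(P i) x = 0) ->
  forall x, \sum_i alpha i * \1_(epi (P i)) x = 0.
Proof.
move=> pP sum0 x.
have indicS (A : I -> set 'rV[R]_n) z :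
    \sum_i alpha i * \1_(A i) z = \sum_(i | `[< A i z >]) alpha i.
  rewrite [RHS]big_mkcond; apply: eq_bigr => i _; rewrite indic_asbool.
  by case: `[< _ >]; rewrite ?mulr1 ?mulr0.
rewrite (pt_surj x); set s := x 0 ord0; set v := \row_j _.
pose H c := [set y : 'rV[R]_n | dot v y <= c].
have main (c : R) : \sum_(i | `[< (P i `&` H c) !=set0 >]) alpha i = 0.
  apply: euler_relation => [i|i|y].
  - by apply: closedI; [apply: polyhedron_closed | exact: closed_halfspace].
  - by apply: convexI; [apply: polyhedron_convex | exact: convex_halfspace].
  have [Hy|nHy] := pselect (H c y).
    rewrite -[RHS](sum0 y) indicS; apply: eq_bigl => i.
    by apply/asboolP/asboolP => [[]|].
  by rewrite big1// => i /asboolP[].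
have all0 : \sum_i alpha i = 0.
  have := @euler_relation n I alpha P (fun i => polyhedron_closed (pP i))
    (fun i => polyhedron_convex (pP i)) (fun y => etrans (esym (indicS P y)) (sum0 y)).
  by move=> E; rewrite -[RHS]E; apply: eq_bigl => i; apply/esym/asboolP; case: (pP i).
have /choice [y Hy] : forall i, exists y, (P i `&` [set y | dot v y < - s]) !=set0 ->
    (P i `&` [set y | dot v y < - s]) y.
  by move=> i; have [[y Qy]|] := pselect ((P i `&` [set y | dot v y < - s]) !=set0);
    [exists y|exists 0].
(* [c] is so close to [- s] that every chosen point with value below [- s] has value below [c]. *)
have [c cs gap] := gap_below [seq dot v (y i) | i <- enum I] (- s).
transitivity (\sum_i alpha i - \sum_(i | `[< (P i `&` H c) !=set0 >]) alpha i); last first.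
  by rewrite all0 main subr0.
rewrite [\sum_(i | `[< _ >]) _]big_mkcond -sumrB; apply: eq_bigr => i _.
rewrite indic_asbool; case: ifPn => /asboolP ne.
  rewrite subrr (_ : `[< _ >] = false) ?mulr0//; apply/asboolP => /epi_pt E.
  have [z [Pz Hz]] := ne; have {}Hz : dot v z <= c := Hz.
  by have := E z Pz; lra.
rewrite subr0 (_ : `[< _ >] = true) ?mulr1//; apply/asboolP/epi_pt => z Pz.
rewrite leNgt; apply/negP => zs; apply: ne.
have ne' : (P i `&` [set y | dot v y < - s]) !=set0.
  by exists z; split=> //; rewrite /mkset ltrNr.
exists (y i); have [Py ys] := Hy i ne'; split=> //.
have {}ys : dot v (y i) < - s := ys.
rewrite /H /mkset leNgt; apply/negP => /ltW/gap.
rewrite (map_f (fun i => dot v (y i))) ?mem_enum// => /(_ isT).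
by rewrite leNgt ys.
Qed.

End Euler.

(** * Simplicial refinement by perturbation *)

Section Polynomials.
Context {R : realType}.

Lemma roots_finite (p : {poly R}) : p != 0 ->
  exists s : seq R, forall x, root p x -> x \in s.
Proof.
elim: (size p) {-2}p (leqnn (size p)) => [|n IH] {}p sp p0.
  by move: sp; rewrite leqn0 size_poly_eq0 (negPf p0).
have [[c /factor_theorem [q pE]]|none] := pselect (exists c, root p c); last first.
  by exists [::] => x rx; case: none; exists x.
have q0 : q != 0 by apply: contraNneq p0 => q0; rewrite pE q0 mul0r.
have [|s Hs] := IH q _ q0.
  by move: sp; rewrite pE size_Mmonic ?monicXsubC// size_XsubC addn2.
exists (c :: s) => x; rewrite pE rootM root_XsubC inE => /orP[/Hs ->|->//].
by rewrite orbT.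
Qed.

(** Before the first positive root the sign is constant; a negative value at 0 followed by a
    nonnegative one would produce a root in between. *)
Lemma poly_sign_near0 (p : {poly R}) : p != 0 ->
  exists2 e, 0 < e & forall t, 0 < t <= e ->
    p.[t] != 0 /\ (0 <= p.[t] -> 0 <= p.[0]).
Proof.
move=> p0; have [s Hs] := roots_finite p0.
have [e e0 gap] := gap_above s 0.
have noroot x : 0 < x <= e -> p.[x] != 0.
  by move=> /andP[x0 xe]; apply/negP => /Hs/gap/(_ xe); rewrite leNgt x0.
exists e => // t /[dup] /noroot pt0 /andP[t_gt0 te]; split=> // pt_ge0.
rewrite leNgt; apply/negP => p0_lt0.
have [|x] := poly_ivt (ltW t_gt0) (p := p); first by rewrite (ltW p0_lt0).
move=> /andP[x0 xt] rx.
have [x_eq0|x_neq0] := eqVneq x 0.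
  by move: rx p0_lt0; rewrite x_eq0 => /eqP ->; rewrite ltxx.
have /noroot/negP : 0 < x <= e by rewrite lt0r x_neq0 x0 (le_trans xt).
by apply.
Qed.

Lemma polys_sign_near0 (I : finType) (P : pred I) (p : I -> {poly R}) :
  (forall i, P i -> p i != 0) ->
  exists2 t, 0 < t &
    forall i, P i -> (p i).[t] != 0 /\ (0 <= (p i).[t] -> 0 <= (p i).[0]).
Proof.
move=> p0; suff [e e0 He] : exists2 e, 0 < e &
    forall t, 0 < t <= e -> forall i, i \in enum I -> P i ->
    (p i).[t] != 0 /\ (0 <= (p i).[t] -> 0 <= (p i).[0]).
  by exists e => // i; apply: He; rewrite ?e0 ?lexx ?mem_enum.
elim: (enum I) => [|i r [e e0 He]]; first by exists 1.
have [Pi|nPi] := boolP (P i); last first.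
  by exists e => // t te j; rewrite inE => /predU1P[->|]; [rewrite (negPf nPi)|apply: He].
have [e' e'0 He'] := poly_sign_near0 (p0 i Pi).
exists (Num.min e e'); first by rewrite lt_min e0.
move=> t; rewrite le_min => /and3P[t0 te te'] j; rewrite inE => /predU1P[->|jr].
  by move=> _; apply: He'; rewrite t0.
by apply: He => //; rewrite t0.
Qed.

Lemma small_step (I : finType) (s c : I -> R) :
  exists2 e, 0 < e & forall i, 0 < s i -> e * `|c i| < s i.
Proof.
suff [e e0 He] : exists2 e, 0 < e & forall i, i \in enum I -> 0 < s i -> e * `|c i| < s i.
  by exists e => // i; apply: He; rewrite mem_enum.
elim: (enum I) => [|i r [e e0 He]]; first by exists 1.
have [si|si] := ltP 0 (s i); last first.
  by exists e => // j; rewrite inE => /predU1P[->|/He//]; rewrite ltNge si.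
have c0 : 0 < 1 + `|c i| by rewrite ltr_wpDr.
exists (Num.min e (s i / (1 + `|c i|))); first by rewrite lt_min e0 divr_gt0.
move=> j; rewrite inE => /predU1P[-> _|jr sj].
  apply: (@le_lt_trans _ _ (s i / (1 + `|c i|) * `|c i|)).
    by rewrite ler_wpM2r// ge_min lexx orbT.
  rewrite mulrAC ltr_pdivrMr// ltr_pM2l//; lra.
apply: le_lt_trans (He j jr sj); rewrite ler_wpM2r// ge_min lexx//.
Qed.

End Polynomials.

(** * Vertices and perturbation of a system of inequalities *)

Section System.
Context {R : realType} {d m : nat} (a : 'I_m -> 'rV[R]_d).
Implicit Types (beta : 'I_m -> R) (v y l : 'rV[R]_d).

Definition feasible beta y : Prop := forall i, dot (a i) y <= beta i.
(** A nonempty solution set then contains no line. *)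
Definition pointed : Prop := forall l, (forall i, dot (a i) l = 0) -> l = 0.
(** For a nonempty solution set these are the [v] that are bounded below on it. *)
Definition recession_ge0 v : Prop :=
  forall l, (forall i, dot (a i) l <= 0) -> 0 <= dot v l.
Definition is_vertex beta y : Prop :=
  feasible beta y /\
  forall l, (forall i, dot (a i) y = beta i -> dot (a i) l = 0) -> l = 0.

(** Induction on the number of inactive constraints: at a point that is not a vertex, one moves
    along a line inside all active constraints, without increasing [v], until a further constraint
    becomes active. *)
Lemma vertex_descent beta v y : pointed -> recession_ge0 v -> feasible beta y ->
  exists2 y', is_vertex beta y' & dot v y' <= dot v y.
Proof.
move=> apt rv; have [n] := ubnP #|[pred i | dot (a i) y != beta i]|.
elim: n y => // n IH y ncard fy.
have [yv|nyv] := pselect (is_vertex beta y); first by exists y.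
have [l0 [l0act l00]] : exists l,
    (forall i, dot (a i) y = beta i -> dot (a i) l = 0) /\ l <> 0.
  by apply: contra_notP nyv => H; split=> // l Hl; apply: contra_notP H; exists l.
(* The direction is [l0] or its opposite. Some constraint blocks it: by the recession hypothesis if
   [v] decreases strictly, by pointedness and a choice of sign if [v] is constant. *)
have [l [lact lv [i0 li0]]] : exists l,
    [/\ forall i, dot (a i) y = beta i -> dot (a i) l = 0,
    dot v l <= 0 & exists i, 0 < dot (a i) l].
  have pos l : dot v l < 0 -> exists i, 0 < dot (a i) l.
    move=> vl; apply: contrapT => none; have : 0 <= dot v l; last by lra.
    by apply: rv => i; rewrite leNgt; apply/negP => ai; apply: none; exists i.
  have [vl|vl|vl] := ltgtP (dot v l0) 0.
  - by exists l0; split=> //; [apply: ltW | apply: pos].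
  - exists (- l0); split.
    + by move=> i /l0act; rewrite dotNr => ->; rewrite oppr0.
    + by rewrite dotNr; lra.
    + by apply: pos; rewrite dotNr; lra.
  have [i ai] : exists i, dot (a i) l0 <> 0.
    by apply: contrapT => none; apply/l00/apt => i; apply: contrapT => ai; apply: none; exists i.
  have [ai0|ai0|//] := ltgtP (dot (a i) l0) 0.
    exists (- l0); split.
    + by move=> j /l0act; rewrite dotNr => ->; rewrite oppr0.
    + by rewrite dotNr vl oppr0.
    + by exists i; rewrite dotNr; lra.
  by exists l0; split=> //; [rewrite vl | exists i].
(* The step length at which constraint [i] becomes active; the smallest one is taken. *)
pose theta i := (beta i - dot (a i) y) / dot (a i) l.
have [i /= li imin] := arg_minP (P := fun i => 0 < dot (a i) l) theta li0.
have th0 : 0 <= theta i by rewrite divr_ge0 ?subr_ge0 ?fy// ltW.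
have fy' : feasible beta (y + theta i *: l).
  move=> j; rewrite dotDr dotZr.
  have [lj|lj] := ltP 0 (dot (a j) l).
    have := imin j lj; rewrite {2}/theta ler_pdivlMr//; lra.
  have := fy j; nra.
have [|y' y'v y'le] := IH (y + theta i *: l) _ fy'; last first.
  by exists y' => //; apply: le_trans y'le _; rewrite dotDr dotZr; nra.
rewrite -ltnS; apply: leq_trans ncard; rewrite ltnS; apply: proper_card.
apply/properP; split.
     apply/fintype.subsetP => j; rewrite !inE; apply: contra => /eqP jact.
  by rewrite dotDr dotZr lact// mulr0 addr0 jact.
exists i; rewrite !inE.
  by apply/negP => /eqP/lact; lra.
by rewrite negbK dotDr dotZr divfK ?(lt0r_neq0 li)// addrC subrK.
Qed.

Lemma spanning_full k (A : 'M[R]_(k, d)) :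
  (forall l, (forall i, dot (row i A) l = 0) -> l = 0) -> row_full A.
Proof.
move=> H; suff: row_free A^T by rewrite /row_free mxrank_tr.
rewrite -kermx_eq0; apply/eqP/row_matrixP => i; rewrite row0; apply: H => j.
have /rowP/(_ j) : row i (kermx A^T) *m A^T = 0 by rewrite -row_mul mulmx_ker row0.
rewrite !mxE => E; rewrite /dot -[RHS]E; apply: eq_bigr => l _.
by rewrite !mxE mulrC.
Qed.

(** Bases are finite functions, hence ordered and possibly repetitive; they form a finite type, and
    invertibility selects the genuine ones. *)
Definition basis_mx (f : {ffun 'I_d -> 'I_m}) : 'M[R]_d := \matrix_k a (f k).

Definition basic_point beta f : 'rV[R]_d :=
  (invmx (basis_mx f) *m \col_k beta (f k))^T.

Lemma row_basis_mx f k : row k (basis_mx f) = a (f k).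
Proof. exact: rowK. Qed.

Lemma mul_basis_mx f y : basis_mx f *m y^T = \col_k dot (a (f k)) y.
Proof.
apply/colP => k; rewrite !mxE; apply: eq_bigr => j _.
by rewrite !mxE.
Qed.

Lemma dot_basic_point beta f k : basis_mx f \in unitmx ->
  dot (a (f k)) (basic_point beta f) = beta (f k).
Proof.
move=> fu; have := mul_basis_mx f (basic_point beta f).
by rewrite trmxK mulKVmx// => /colP/(_ k); rewrite !mxE => <-.
Qed.

Lemma basic_point_uniq beta f y : basis_mx f \in unitmx ->
  (forall k, dot (a (f k)) y = beta (f k)) -> y = basic_point beta f.
Proof.
move=> fu Hy; apply: trmx_inj; rewrite trmxK -[y^T](mulKmx fu) mul_basis_mx.
by congr (_ *m _); apply/colP => k; rewrite !mxE.
Qed.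

Lemma vertex_basis beta y : is_vertex beta y ->
  exists f, [/\ basis_mx f \in unitmx, y = basic_point beta f
    & forall k, dot (a (f k)) y = beta (f k)].
Proof.
move=> [fy Hy]; pose A := \matrix_(i < m)
  (if dot (a i) y == beta i then a i else 0).
have rowA i : row i A = if dot (a i) y == beta i then a i else 0 by exact: rowK.
have Af : row_full A.
  apply: spanning_full => l Hl; apply: Hy => i iact.
  by have := Hl i; rewrite rowA iact eqxx.
have fu := fullrowsub_unit Af; set g := fullrankfun Af in fu.
(* Inactive constraints were replaced by zero rows, which an invertible submatrix cannot contain. *)
have gact k : dot (a (g k)) y = beta (g k).
  apply: contraTeq fu => /negPf gk.
  have r0 : row k (rowsub g A) = 0 by rewrite row_rowsub rowA gk.
  apply/negP => fu; have : row k (rowsub g A *m invmx (rowsub g A)) = 0.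
    by rewrite row_mul r0 mul0mx.
  rewrite mulmxV// => /rowP/(_ k); rewrite !mxE eqxx => /eqP.
  by rewrite oner_eq0.
pose f : {ffun 'I_d -> 'I_m} := [ffun k => g k].
have fg : basis_mx f = rowsub g A.
  apply/row_matrixP => k; rewrite row_basis_mx row_rowsub rowA gact eqxx.
  by rewrite ffunE.
exists f; rewrite fg; split=> // [|k]; last by rewrite ffunE gact.
by apply: basic_point_uniq; [rewrite fg | move=> k; rewrite ffunE gact].
Qed.

Variable b : 'I_m -> R.

(** The exponents are distinct and positive, so each constraint owns a monomial and the system at
    [t = 0] is the original one. *)
Definition perturb t (i : 'I_m) : R := b i + t ^+ i.+1.

Definition slack_poly (f : {ffun 'I_d -> 'I_m}) i : {poly R} :=
  (b i)%:P + 'X^(i.+1) -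
  \sum_k (a i *m invmx (basis_mx f)) 0 k *: ((b (f k))%:P + 'X^((f k).+1)).

Lemma slack_polyE f i t : (slack_poly f i).[t] =
  perturb t i - dot (a i) (basic_point (perturb t) f).
Proof.
rewrite /slack_poly hornerD hornerN hornerD hornerC hornerXn horner_sum.
rewrite -/(perturb t i); congr (_ - _).
rewrite /basic_point dotE trmxK mulmxA mxE; apply: eq_bigr => k _.
by rewrite hornerZ hornerD hornerC hornerXn [X in _ = _ * X]mxE.
Qed.

(** The monomial of a constraint outside the basis cannot be cancelled by those of the basis. *)
Lemma slack_poly_neq0 (f : {ffun 'I_d -> 'I_m}) (i : 'I_m) :
  i \notin codom f -> slack_poly f i != 0.
Proof.
move=> fi; have : (slack_poly f i)`_i.+1 = 1.
  rewrite coefB coefD coefC coefXn eqxx add0r coef_sum big1 ?subr0// => k _.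
  rewrite coefZ coefD coefC coefXn eqSS add0r (_ : (_ == _) = false) ?mulr0//.
  by apply/negP => /eqP/val_inj ik; move: fi; rewrite ik codom_f.
by apply: contra_eqN => /eqP ->; rewrite coef0 eq_sym oner_eq0.
Qed.

Lemma perturb0 : perturb 0 =1 b.
Proof. by move=> i; rewrite /perturb expr0n addr0. Qed.

Lemma basic_point_perturb0 f : basic_point (perturb 0) f = basic_point b f.
Proof.
by congr ((_ *m _)^T); apply/colP => k; rewrite !mxE perturb0.
Qed.

(** One small [t] suits all of the finitely many slack polynomials. Only basis constraints are then
    active at a basic point, and a basis feasible after perturbation was feasible before. *)
Lemma simple_perturbation : exists2 t, 0 < t &
  forall (f : {ffun 'I_d -> 'I_m}) (i : 'I_m), i \notin codom f ->
  dot (a i) (basic_point (perturb t) f) != perturb t i /\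
  (dot (a i) (basic_point (perturb t) f) <= perturb t i ->
   dot (a i) (basic_point b f) <= b i).
Proof.
have [t t0 Ht] := @polys_sign_near0 R ({ffun 'I_d -> 'I_m} * 'I_m)%type
  (fun p => p.2 \notin codom p.1) (fun p => slack_poly p.1 p.2)
  (fun p => @slack_poly_neq0 p.1 p.2).
exists t => // f i fi; have := Ht (f, i) fi; rewrite /= !slack_polyE !subr_ge0.
by rewrite perturb0 basic_point_perturb0 subr_eq0 eq_sym.
Qed.

End System.

(** * Simplicial cones from the bases of a perturbed system *)

Section NormalTriangulation.
Context {R : realType}.

Lemma incone_sum n (V : 'M[R]_n) x : V \in unitmx ->
  x = \sum_k (x *m invmx V) 0 k *: row k V.
Proof. by move=> Vu; rewrite -mulmx_sum_row mulmxKV. Qed.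

Lemma incone_row n (V : 'M[R]_n) k : V \in unitmx -> incone V (row k V).
Proof.
move=> Vu; apply/forallP => j; rewrite -row_mul mulmxV// !mxE.
exact: ler0n.
Qed.

Lemma incone_comb n (V : 'M[R]_n) (I : finType) (c : I -> R) (u : I -> 'rV[R]_n) :
  (forall i, 0 <= c i) -> (forall i, c i != 0 -> incone V (u i)) ->
  incone V (\sum_i c i *: u i).
Proof.
move=> c0 Vu; apply/forallP => j; rewrite mulmx_suml summxE.
apply: sumr_ge0 => i _; rewrite -scalemxAl mxE.
have [->|ci] := eqVneq (c i) 0; first by rewrite mul0r.
by rewrite mulr_ge0//; have /forallP := Vu i ci; apply.
Qed.

Context {d m : nat} (a : 'I_m -> 'rV[R]_d) (b : 'I_m -> R).

(** The cones belong to the bases that are feasible after perturbation, while [y] collects the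
    unperturbed basic points. As in the simplex method, [v] lies in the cone of a basis minimizing
    it; two cones are separated by the difference of their perturbed vertices. *)
Lemma normal_triangulation : pointed a -> (exists y, feasible a b y) ->
  exists (I : finType) (T : I -> 'M[R]_d) (y : I -> 'rV[R]_d)
    (idx : I -> 'I_d -> 'I_m),
  [/\ forall i, T i \in unitmx /\ forall k, row k (T i) = - a (idx i k),
      forall i, feasible a b (y i) /\
        forall k, dot (a (idx i k)) (y i) = b (idx i k),
      forall v, recession_ge0 a v -> exists i, incone (T i) v
    & forall i j, i != j -> exists2 n, n != 0 &
        [/\ forall x, incone (T i) x -> 0 <= dot n x,
            forall x, incone (T j) x -> dot n x <= 0
          & forall x, incone (T i) x -> dot n x = 0 -> incone (T j) x]].
Proof.
move=> apt [y0 fy0]; have [t t0 simple] := simple_perturbation a b.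
pose beta := perturb b t; pose F := {ffun 'I_d -> 'I_m}.
have fy0' : feasible a beta y0.
  by move=> i; rewrite (le_trans (fy0 i))// /beta /perturb lerDl exprn_ge0// ltW.
pose pb f := basic_point a beta f.
pose good (f : F) := (basis_mx a f \in unitmx) &&
  [forall i, dot (a i) (pb f) <= beta i].
pose same (f g : F) := [forall i, (i \in codom g) == (i \in codom f)].
(* The orderings of a basis define the same cone; [canon] retains one of them. *)
pose canon (f : F) := odflt f [pick g | good g && same f g].
(* Simplicity: the perturbed vertex determines the set of constraints in its basis. *)
have act f i : good f -> (dot (a i) (pb f) == beta i) = (i \in codom f).
  move=> /andP[fu _]; have [/codomP[k ->]|/simple [/negPf //]] := boolP (i \in codom f).
  by rewrite dot_basic_point// eqxx.
have canonP f : good f -> good (canon f) /\ codom (canon f) =i codom f.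
  move=> gf; rewrite /canon; case: pickP => [g /andP[gg /forallP fg]|/(_ f)].
    by split=> // i; exact/eqP.
  by rewrite gf /same /=; case: forallP => // -[] i; rewrite eqxx.
have canon_eq f g : good f -> good g -> codom f =i codom g -> canon f = canon g.
  move=> gf gg fg; rewrite /canon.
  rewrite (eq_pick (Q := fun h => good h && same f h)); last first.
    by move=> h /=; congr (_ && _); apply: eq_forallb => i; rewrite fg.
  by case: pickP => // /(_ f); rewrite gf /same /=; case: forallP => // -[] i; rewrite eqxx.
have good_pt f : good f -> feasible a b (basic_point a b f).
  move=> /andP[fu /forallP gf] i.
  have [/codomP[k ->]|/simple [_]] := boolP (i \in codom f); last by apply.
  by rewrite dot_basic_point.
have Tu f : good f -> - basis_mx a f \in unitmx.
  by move=> /andP[fu _]; rewrite -scaleN1r unitmxZ ?unitrN1.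
have rowT f k : row k (- basis_mx a f) = - a (f k).
  by apply/rowP => j; rewrite !mxE.
exists {f : F | good f && (canon f == f)}, (fun i => - basis_mx a (val i)),
  (fun i => basic_point a b (val i)), (fun i k => (val i : F) k); split.
- by move=> [f /= /andP[gf _]]; split; [exact: Tu | exact: rowT].
- move=> [f /= /andP[gf _]]; split; first exact: good_pt.
  by move=> k; rewrite dot_basic_point//; case/andP: gf.
- move=> v rv.
  have vertexF y : is_vertex a beta y -> exists2 f, good f & y = pb f.
    move=> /[dup] -[fy _] /vertex_basis [f [fu yE _]].
    exists f; rewrite // /good fu; apply/forallP => i.
    by rewrite /pb -yE fy.
  have [y1 y1v _] := vertex_descent apt rv fy0'.
  have [f0 gf0 _] := vertexF y1 y1v.
  have [f gf fmin] := arg_minP (P := good) (fun f => dot v (pb f)) gf0.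
  suff vf : incone (- basis_mx a f) v.
    have [gc cc] := canonP f gf.
    have cP : good (canon f) && (canon (canon f) == canon f).
      by rewrite gc; apply/eqP/canon_eq.
    exists (exist (fun f : F => good f && (canon f == f)) (canon f) cP) => /=.
    rewrite (incone_sum v (Tu _ gf)).
    apply: incone_comb => [k|k _]; first exact: (forallP vf).
    rewrite rowT; have /codomP[l ->] : f k \in codom (canon f) by rewrite cc codom_f.
    by rewrite -rowT incone_row// Tu.
  apply/forallP => k; rewrite leNgt; apply/negP => lk.
  have fu : basis_mx a f \in unitmx by case/andP: gf.
  (* The edge direction along which constraint [f k] is relaxed at unit rate and the other basis
     constraints stay active; [v] changes at the rate of its negative [k]-th coordinate. *)
  pose del := - (col k (invmx (basis_mx a f)))^T.
  have adel j : dot (a (f j)) del = - (j == k)%:R.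
    have := mul_basis_mx a f del; rewrite linearN /= trmxK mulmxN colE mulKVmx//.
    by move=> /colP/(_ j); rewrite !mxE eqxx andbT => <-.
  have vdel : dot v del < 0.
    rewrite {1}(incone_sum v (Tu _ gf)) dot_suml (bigD1 k)//= big1 => [|j jk].
      by rewrite addr0 dotZl rowT dotNl adel eqxx opprK mulr1.
    by rewrite dotZl rowT dotNl adel (negPf jk) oppr0 oppr0 mulr0.
  (* Constraints outside the basis are slack at the vertex, so a short step is feasible; descending
     from there contradicts the minimality of [f]. *)
  have [e e0 He] := small_step (fun i => beta i - dot (a i) (pb f))
    (fun i => dot (a i) del).
  have fy : feasible a beta (pb f + e *: del).
    move=> i; rewrite dotDr dotZr.
    have [/codomP[j ->]|fi] := boolP (i \in codom f).
      rewrite adel dot_basic_point// mulrN gerBl mulr_ge0 ?ler0n ?ltW//.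
    have : 0 < beta i - dot (a i) (pb f).
      rewrite subr_gt0 lt_neqAle act// fi; case/andP: gf => _ /forallP; exact.
    move=> /He; have := ler_norm (dot (a i) del); nra.
  have [y2 y2v y2le] := vertex_descent apt rv fy.
  have [g gg y2E] := vertexF y2 y2v.
  by have := fmin g gg; rewrite -y2E; move: y2le; rewrite dotDr dotZr; nra.
move=> [f fP] [g gP] /eqP fg /=; have [gf cf] := andP fP; have [gg cg] := andP gP.
(* The increase of [x] between two vertices is a nonnegative combination of slacks at the second
   one. *)
have sep h h' x : good h -> good h' -> incone (- basis_mx a h) x ->
    dot x (pb h' - pb h) = \sum_k (x *m invmx (- basis_mx a h)) 0 k *
      (beta (h k) - dot (a (h k)) (pb h')).
  move=> gh gh' xh; rewrite {1}(incone_sum x (Tu _ gh)) dot_suml.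
  apply: eq_bigr => k _; rewrite dotZl rowT dotNl dotBr dot_basic_point.
    by rewrite opprB.
  by case/andP: gh.
have slack_ge0 h i : good h -> 0 <= beta i - dot (a i) (pb h).
  by move=> /andP[_ /forallP]; rewrite subr_ge0; apply.
exists (pb g - pb f); last split => x.
- rewrite subr_eq0; apply/eqP => pgf; apply: fg; apply/eqP; rewrite -val_eqE /=.
  rewrite -(eqP cf) -(eqP cg) (canon_eq f g)// => i.
  by rewrite -!act// pgf.
- move=> xf; rewrite dotC sep//; apply: sumr_ge0 => k _.
  by rewrite mulr_ge0 ?slack_ge0//; exact: (forallP xf).
- move=> xg; rewrite -opprB dotNl oppr_le0 dotC sep//; apply: sumr_ge0 => k _.
  by rewrite mulr_ge0 ?slack_ge0//; exact: (forallP xg).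
(* If the increase is 0, every generator with positive weight is active at the vertex of [g], hence
   is a generator of its cone. *)
move=> xf; rewrite dotC sep// => /eqP; rewrite psumr_eq0; last first.
  by move=> k _; rewrite mulr_ge0 ?slack_ge0//; exact: (forallP xf).
move=> /allP H; rewrite (incone_sum x (Tu _ gf)); apply: incone_comb => [k|k lk].
  exact: (forallP xf).
have := H k (mem_index_enum k); rewrite mulf_eq0 (negPf lk)/= subr_eq0 eq_sym act//.
by rewrite rowT => /codomP[l ->]; rewrite -rowT incone_row// Tu.
Qed.

End NormalTriangulation.

(** * Normal fans and dual volumes *)

Section Dimension.
Context {R : realType}.

Lemma lin_dim_le d (S : set 'rV[R]_d) k :
  (forall k' (A : 'M[R]_(k', d)), row_free A -> (forall i, S (row i A)) ->
     (k' <= k)%N) -> (lin_dim S <= k)%N.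
Proof.
by move=> H; apply/bigmax_leqP => k' /asboolP[A [fA SA]]; exact: H fA SA.
Qed.

Lemma lin_dim_ge d (S : set 'rV[R]_d) k (A : 'M[R]_(k, d)) :
  row_free A -> (forall i, S (row i A)) -> (k <= lin_dim S)%N.
Proof.
move=> fA SA; have kd : (k < d.+1)%N by rewrite ltnS -(eqP fA) rank_leq_col.
apply: (leq_bigmax_cond (Ordinal kd)); apply/asboolP; by exists A.
Qed.

Lemma row_free_orthogonal d k (A : 'M[R]_(k, d)) n :
  row_free A -> n != 0 -> (forall i, dot (row i A) n = 0) -> (k < d)%N.
Proof.
move=> fA n0 An; have : A *m n^T = 0.
  apply/colP => i; rewrite [RHS]mxE -[RHS](An i) dotE -row_mul.
  by rewrite [RHS]mxE.
by move/mulmx0_rank_max; rewrite (eqP fA) mxrank_tr rank_rV n0 addn1.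
Qed.

Lemma lin_dim_hyperplane d (S : set 'rV[R]_d) n : n != 0 ->
  (forall x, S x -> dot n x = 0) -> (lin_dim S < d)%N.
Proof.
move=> n0 Sn; have d0 : (0 < d)%N.
  case: d n n0 {S Sn} => // n /eqP[]; apply/rowP; by case.
suff: (lin_dim S <= d.-1)%N by rewrite -ltnS prednK.
apply: lin_dim_le => k A fA SA; rewrite -ltnS prednK//.
by apply: (row_free_orthogonal fA n0) => i; rewrite dotC Sn.
Qed.

(** Greedy choice: while fewer than [d] vectors are chosen, some [n] is orthogonal to them, and an
    element of [S] not orthogonal to [n] is independent of them. *)
Lemma lin_dim_spanning d (S : set 'rV[R]_d) :
  (forall n, (forall x, S x -> dot n x = 0) -> n = 0) -> lin_dim S = d.
Proof.
move=> HS; suff H k : (k <= d)%N ->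
    exists A : 'M[R]_(k, d), row_free A /\ forall i, S (row i A).
  have [A [fA SA]] := H d (leqnn d); apply/eqP; rewrite eqn_leq (lin_dim_ge fA SA).
  rewrite andbT; apply: lin_dim_le => k A' fA' _.
  by rewrite -(eqP fA') rank_leq_col.
elim: k => [|k IH] kd.
  by exists 0; split; [rewrite /row_free mxrank0 | case].
have [A [fA SA]] := IH (ltnW kd).
have [n n0 An] : exists2 n, n != 0 & forall i, dot (row i A) n = 0.
  apply: contrapT => none; have : row_full A.
    apply: spanning_full => l Hl; apply: contrapT => /eqP l0; apply: none.
    by exists l.
  by rewrite /row_full (eqP fA) => /eqP kd'; move: kd; rewrite kd' ltnn.
have [x Sx nx] : exists2 x, S x & dot x n != 0.
  apply: contrapT => none; move/eqP: n0; apply; apply: HS => x Sx.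
  by apply: contrapT => /eqP nx; apply: none; exists x; rewrite // dotC.
exists (col_mx x A); split.
  apply: inj_row_free => v; rewrite -[v](@hsubmxK _ 1 1 k).
  move: (@lsubmx _ 1 1 k v) (@rsubmx _ 1 1 k v) => {v} u v vE.
  have {}vE : u *m x + v *m A = 0 := etrans (esym (mul_row_col u v x A)) vE.
  have u0 : u = 0.
    have := congr1 (mulmx^~ n^T) vE; rewrite mulmxDl mul0mx -!mulmxA.
    rewrite (_ : A *m n^T = 0) ?mulmx0 ?addr0.
      rewrite [x *m _]mx11_scalar -dotE mul_mx_scalar => /eqP.
      by rewrite scaler_eq0 (negPf nx) => /eqP.
    apply/colP => i; rewrite [RHS]mxE -[RHS](An i) dotE -row_mul.
    by rewrite [RHS]mxE.
  move: vE; rewrite u0 mul0mx add0r => v0.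
  have -> : v = 0 by apply: (row_free_inj fA); rewrite v0 mul0mx.
  by apply: etrans (@row_mx0 _ 1 1 k) _.
move=> i; case: (@split_ordP 1 k i) => j ->.
  by rewrite (ord1 j) (etrans (@rowKu _ 1 k d 0 x A) (row_id _ _)).
by rewrite (@rowKd _ 1 k d j x A).
Qed.

Lemma full_dimensional_not_flat d (P : set 'rV[R]_d) n c :
  full_dimensional P -> (forall y, P y -> dot n y = c) -> n = 0.
Proof.
move=> fP Hn; apply: contrapT => /eqP n0.
suff : (aff_dim P < d)%N by rewrite fP ltnn.
apply: (lin_dim_hyperplane n0) => _ [x Px [y Py <-]].
by rewrite dotBr !Hn// subrr.
Qed.

Lemma flat_not_full_dimensional d (P : set 'rV[R]_d) :
  (P !=set0)%classic -> ~ full_dimensional P ->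
  exists n c, n != 0 /\ forall y, P y -> dot n y = c.
Proof.
move=> [y0 Py0] nfP; apply: contrapT => none; apply: nfP; apply: lin_dim_spanning.
move=> n Hn; apply: contrapT => /eqP n0; apply: none.
exists n, (dot n y0); split=> // y Py; apply/eqP; rewrite -subr_eq0 -dotBr.
by rewrite Hn//; exists y => //; exists y0.
Qed.

End Dimension.

Section NormalCones.
Context {R : realType} {d : nat} (P : set 'rV[R]_d).
Local Open Scope classical_set_scope.

Lemma support_fun_min v y0 : P y0 -> (forall y, P y -> dot v y0 <= dot v y) ->
  support_fun P v = (- dot v y0)%:E.
Proof.
move=> Py0 Hmin; rewrite /support_fun (_ : ereal_inf _ = (dot v y0)%:E)//.
apply/eqP; rewrite eq_le; apply/andP; split.
  by apply: ereal_inf_lbound; exists y0.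
by apply/ereal_infP => _ [y Py <-]; rewrite lee_fin Hmin.
Qed.

Lemma face_sub F : face P F -> F `<=` P.
Proof. by move=> [_ [a [b [_ ->]]]] y []. Qed.

Lemma normal_coneP F v : F !=set0 -> F `<=` P ->
  normal_cone P F v <-> forall y z, F y -> P z -> dot v y <= dot v z.
Proof.
move=> [y0 Fy0] FP; split=> [[_ H] y z Fy Pz|H].
  have /eqP := H y Fy; rewrite /support_fun eqe_oppLR /= opprK => /eqP E.
  by rewrite -lee_fin -E; apply: ereal_inf_lbound; exists z.
have E y : F y -> support_fun P v = (- dot v y)%:E.
  by move=> Fy; apply: support_fun_min => [|z Pz]; [exact: FP | exact: H].
by split=> //; rewrite (E y0).
Qed.

Lemma face_minimizers v y0 : P y0 -> (forall y, P y -> dot v y0 <= dot v y) ->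
  face P [set y | P y /\ dot v y = dot v y0].
Proof. by move=> Py0 Hmin; split; [exists y0 | exists v, (dot v y0)]. Qed.

Lemma normal_fan_minimizer v y0 : P y0 -> (forall y, P y -> dot v y0 <= dot v y) ->
  exists2 C, normal_fan P C & C v.
Proof.
move=> Py0 Hmin; exists (normal_cone P [set y | P y /\ dot v y = dot v y0]).
  by exists [set y | P y /\ dot v y = dot v y0] => //; exact: face_minimizers.
apply/normal_coneP => [|y []//|y z [_ ->] Pz]; first by exists y0.
exact: Hmin.
Qed.

Lemma normal_fanP C : normal_fan P C -> exists2 y0, P y0 &
  forall v, C v -> forall y, P y -> dot v y0 <= dot v y.
Proof.
move=> [F fF ->]; have [[y0 Fy0] _] := fF; exists y0; first exact: face_sub fF _ Fy0.
move=> v /normal_coneP H y Py; apply: H => //; first by exists y0.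
exact: face_sub.
Qed.

Lemma normal_fan_nonempty : P !=set0 -> exists2 C, normal_fan P C & C 0.
Proof.
by move=> [y0 Py0]; apply: (normal_fan_minimizer Py0) => y _; rewrite !dot0l.
Qed.

End NormalCones.

(** * Dual volumes as values of [sigma] on epigraphs *)

Section Represents.
Context {R : realType} {d : nat}.
Local Notation K := {fraction (mpoly d R)}.
Local Open Scope classical_set_scope.

Definition cst_morphism : {rmorphism R -> K} := @tofrac (mpoly d R) \o @mpolyC d R.

(** The vector w = (1, z) with indeterminate z. *)
Definition variables : 'cV[K]_d.+1 :=
  \col_j oapp (fun l => tofrac (mpolyX R (mnm1 l))) 1 (unlift ord0 j).

Definition affine_form (x : 'rV[R]_d.+1) : mpoly d R :=
  mpolyC d (x 0 ord0) + \sum_(j < d) x 0 (lift ord0 j) *: mpolyX R (mnm1 j).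

Lemma pairing_variables x :
  pairing cst_morphism variables x = tofrac (affine_form x).
Proof.
rewrite /pairing mxE big_ord_recl !mxE unlift_none mulr1 /affine_form.
rewrite [tofrac (_ + _)]rmorphD rmorph_sum; congr +%R.
by apply: eq_bigr => j _; rewrite !mxE liftK /= -mul_mpolyC rmorphM.
Qed.

Lemma affine_form_neq0 x : x != 0 -> affine_form x != 0.
Proof.
apply: contraNN => /eqP E; apply/eqP; rewrite (pt_surj x).
have x0 : x 0 ord0 = 0.
  have := congr1 (mcoeff mnm0) E; rewrite mcoeffD mcoeffC eqxx mulr1 mcoeff0.
  rewrite raddf_sum /= big1 ?addr0// => j _.
  by rewrite mcoeffZ mcoeffX mnm1_eq0 mulr0.
apply/eqP; rewrite pt_eq0 x0 eqxx; apply/eqP/rowP => j; rewrite !mxE.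
have := congr1 (mcoeff (mnm1 j)) E; rewrite /affine_form x0 mpolyC0 add0r mcoeff0.
rewrite raddf_sum /= (bigD1 j)//= big1 => [|l lj].
  by rewrite mcoeffZ mcoeffXU eqxx mulr1 addr0.
by rewrite mcoeffZ mcoeffXU (negPf lj) mulr0.
Qed.

(** As z is a vector of indeterminates, no nonzero generator is orthogonal to (1, z), and no
    denominator vanishes. *)
Lemma pairing_variables_neq0 x : x != 0 -> pairing cst_morphism variables x != 0.
Proof. by move=> x0; rewrite pairing_variables tofrac_eq0 affine_form_neq0. Qed.

Lemma row_unitmx_neq0 n (V : 'M[R]_n) j : V \in unitmx -> row j V != 0.
Proof.
move=> Vu; apply/eqP => /(congr1 (mulmx^~ (invmx V))).
rewrite -row_mul mulmxV// mul0mx => /rowP/(_ j); rewrite !mxE eqxx => /eqP.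
by rewrite oner_eq0.
Qed.

(** By [sigma_additiveT] there is at most one such [f], whatever the decomposition of the
    epigraph. *)
Definition represents (P : set 'rV[R]_d) (f : K) : Prop :=
  exists (I : finType) (V : I -> 'M[R]_d.+1),
    [/\ forall i, V i \in unitmx,
        generically (fun x => \sum_i (incone (V i) x)%:R = \1_(epi P) x :> R)
      & f = \sum_i sigma cst_morphism variables (V i)].

(* The part of the epigraph lying above [cone_of T], if the support function is
   linear there and takes the value [h k] at the [k]-th row. *)
Definition lift_mx (h : 'I_d -> R) (T : 'M[R]_d) : 'M[R]_d.+1 :=
  \matrix_i oapp (fun k => pt (h k) (row k T)) (pt 1 0) (unlift ord0 i).

Lemma row_lift_mx0 h T : row ord0 (lift_mx h T) = pt 1 0.
Proof. by rewrite rowK unlift_none. Qed.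

Lemma row_lift_mxS h T k : row (lift ord0 k) (lift_mx h T) = pt (h k) (row k T).
Proof. by rewrite rowK liftK. Qed.

Lemma det_lift_mx h T : \det (lift_mx h T) = \det T.
Proof.
rewrite (expand_det_row _ ord0) big_ord_recl big1 => [|j _]; last first.
  by rewrite [lift_mx h T ord0 _]mxE unlift_none ptS mxE mul0r.
rewrite [lift_mx h T ord0 _]mxE unlift_none pt0 mul1r addr0 /cofactor addn0 expr0 mul1r.
by congr (\det _); apply/matrixP => i j; rewrite !mxE liftK /= ptS mxE.
Qed.

(** With respect to the rows, the first coordinate of [pt s v] is its height above the linear
    function taking the values [h] on the generators. *)
Lemma incone_lift_mx h T s v : T \in unitmx ->
  incone (lift_mx h T) (pt s v) =
  incone T v && (\sum_k (v *m invmx T) 0 k * h k <= s).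
Proof.
move=> Tu; set lam := v *m invmx T; set c := \sum_k _.
have Lu : lift_mx h T \in unitmx by rewrite unitmxE det_lift_mx -unitmxE.
have E : pt s v *m invmx (lift_mx h T) = pt (s - c) lam.
  apply: (can_inj (mulmxK Lu)); rewrite mulmxKV// mulmx_sum_row big_ord_recl.
  rewrite row_lift_mx0 pt0; under eq_bigr do rewrite ptS row_lift_mxS.
  apply/rowP => j; rewrite [RHS]mxE summxE; case: (unliftP ord0 j) => [l ->|->].
    rewrite ptS [X in X + _]mxE ptS [X in _ * X + _]mxE mulr0 add0r.
    rewrite -[v in LHS](mulmxKV Tu) -/lam mxE.
    by apply: eq_bigr => k _; rewrite [RHS]mxE ptS [X in _ = _ * X]mxE.
  rewrite pt0 [X in X + _]mxE pt0 mulr1.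
  rewrite (eq_bigr (fun k => lam 0 k * h k)) ?subrK// => k _.
  by rewrite [LHS]mxE pt0.
rewrite /incone E; apply/forallP/andP => [H|[/forallP H cs] j].
  split; first by apply/forallP => j; have := H (lift ord0 j); rewrite ptS.
  by have := H ord0; rewrite pt0 subr_ge0.
by case: (unliftP ord0 j) => [l ->|->]; rewrite ?ptS ?H// pt0 subr_ge0.
Qed.

Lemma sigma_lift_mx h T : sigma cst_morphism variables (lift_mx h T) =
  ratfun_cst `|\det T| / \prod_k tofrac (affine_form (pt (h k) (row k T))).
Proof.
rewrite /sigma det_lift_mx big_ord_recl row_lift_mx0 pairing_variables.
rewrite (_ : affine_form _ = 1); last first.
  rewrite /affine_form pt0 mpolyC1 big1 ?addr0// => j _.
  by rewrite ptS mxE scale0r.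
rewrite tofrac1 mul1r; congr (_ / _); apply: eq_bigr => k _.
by rewrite row_lift_mxS pairing_variables.
Qed.

(** On the cone of [T i] the support function is given by the common minimizer [y i], so the lifted
    cone is the part of the epigraph above it. *)
Lemma represents_cones (P : set 'rV[R]_d) (I : finType) (T : I -> 'M[R]_d)
    (y : I -> 'rV[R]_d) :
  (forall i, T i \in unitmx) -> (forall i, P (y i)) ->
  (forall i x z, incone (T i) x -> P z -> dot x (y i) <= dot x z) ->
  (forall s v, epi P (pt s v) -> exists i, incone (T i) v) ->
  (forall i j, i != j -> exists2 n, n != 0 &
     forall x, incone (T i) x -> incone (T j) x -> dot n x = 0) ->
  represents P (\sum_i ratfun_cst `|\det (T i)| /
    \prod_k tofrac (affine_form (pt (- dot (row k (T i)) (y i)) (row k (T i))))).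
Proof.
move=> Tu Py Tmin cover sep.
pose V i := lift_mx (fun k => - dot (row k (T i)) (y i)) (T i).
exists I, V; split; last by apply: eq_bigr => i _; rewrite sigma_lift_mx.
  by move=> i; rewrite unitmxE det_lift_mx -unitmxE.
have VE i s v : incone (V i) (pt s v) = incone (T i) v && (- dot v (y i) <= s).
  rewrite incone_lift_mx//; congr (_ && (_ <= s)).
  rewrite [in RHS](incone_sum v (Tu i)) dot_suml -sumrN.
  by apply: eq_bigr => k _; rewrite dotZl mulrN.
(* Overlaps lie above hyperplanes, so generic points are in at most one lifted cone. *)
have gen : generically (fun x : 'rV[R]_d.+1 => forall p : I * I, p.1 != p.2 ->
    ~~ (incone (V p.1) x && incone (V p.2) x)).
  apply: generically_fin => p; have [->|pp] := eqVneq p.1 p.2.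
    exact: genericallyT.
  have [n n0 Hn] := sep _ _ pp.
  have pn0 : pt 0 n != 0 by rewrite pt_eq0 negb_and n0 orbT.
  apply: generically_imp (generically_neq pn0) => x xn _; apply/negP.
  move: xn; rewrite (pt_surj x) !VE => xn /andP[/andP[x1 _] /andP[x2 _]].
  by move: xn; rewrite dot_pt mul0r add0r Hn// eqxx.
apply: generically_imp gen => x disj; rewrite indic_asbool.
have [|nepi] := pselect (epi P x).
  move=> ex; rewrite (_ : `[< epi P x >] = true); last exact/asboolP.
  have [i Ti] : exists i, incone (V i) x.
    move: ex; rewrite (pt_surj x) => ex; have [i Ti] := cover _ _ ex.
    by exists i; rewrite VE Ti; move/epi_pt: ex; apply.
  rewrite (bigD1 i)//= Ti big1 ?addr0// => j ji.
  by have := disj (j, i) ji; rewrite /= Ti andbT => /negPf ->.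
rewrite (_ : `[< epi P x >] = false); last exact/asboolP.
rewrite big1// => i _; case: (boolP (incone (V i) x)) => // Vi; exfalso; apply: nepi.
move: Vi; rewrite (pt_surj x) VE => /andP[Ti ys]; apply/epi_pt => z Pz.
by apply: le_trans ys; rewrite lerN2 Tmin.
Qed.

End Represents.

(** * Normal fan and epigraph of a polyhedron given by inequalities *)

Section Presentation.
Context {R : realType} {d m : nat} (a : 'I_m -> 'rV[R]_d) (b : 'I_m -> R).
Variable P : set 'rV[R]_d.
Local Open Scope classical_set_scope.
Hypothesis PE : P = [set y | feasible a b y].
Hypothesis P0 : P !=set0.
Local Notation K := {fraction (mpoly d R)}.

Lemma epi_recession s v : epi P (pt s v) -> recession_ge0 a v.
Proof.
move=> /epi_pt H l Hl; rewrite leNgt; apply/negP => vl; have [y0 Py0] := P0.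
(* Chosen so that [s] plus the value of [v] becomes -1 at [y0 + t *: l]. *)
pose t := (s + dot v y0 + 1) / - dot v l.
have s0 : 0 <= s + dot v y0 by have := H y0 Py0; lra.
have t0 : 0 <= t by rewrite divr_ge0//; lra.
have : P (y0 + t *: l).
  move: Py0; rewrite PE => Py0 i /=; rewrite dotDr dotZr.
  by have := Py0 i; have := Hl i; nra.
move=> /H; rewrite dotDr dotZr /t invrN mulrN mulNr divfK ?lt_eqF//; lra.
Qed.

Lemma minimizer_recession v y0 : P y0 -> (forall y, P y -> dot v y0 <= dot v y) ->
  recession_ge0 a v.
Proof.
move=> Py0 H; apply: (@epi_recession (- dot v y0)); apply/epi_pt => y Py.
by rewrite lerN2 H.
Qed.

Lemma basis_cone_min (T : 'M[R]_d) (idx : 'I_d -> 'I_m) y0 x z :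
  T \in unitmx -> (forall k, row k T = - a (idx k)) ->
  (forall k, dot (a (idx k)) y0 = b (idx k)) ->
  incone T x -> P z -> dot x y0 <= dot x z.
Proof.
move=> Tu Trow y0act /forallP Tx; rewrite PE => Pz.
rewrite (incone_sum x Tu) !dot_suml; apply: ler_sum => k _.
by rewrite !dotZl ler_wpM2l// Trow !dotNl lerN2 y0act; exact: Pz.
Qed.

Lemma unitmx_rows_inj n (V : 'M[R]_n) l :
  V \in unitmx -> (forall j, dot (row j V) l = 0) -> l = 0.
Proof.
move=> Vu Hl; apply: trmx_inj; rewrite trmx0 -[l^T](mulKmx Vu).
rewrite (_ : V *m l^T = 0) ?mulmx0//; apply/colP => j.
by rewrite [RHS]mxE -[RHS](Hl j) dotE -row_mul [RHS]mxE.
Qed.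

(** Flat polyhedra are included; for them [represents_flat] then shows that the value is 0. *)
Lemma represents_pointed : pointed a -> exists f : K, represents P f.
Proof.
move=> apt; have feas : exists y, feasible a b y by move: P0; rewrite PE.
have [I [T [y [idx [TP yP cover sep]]]]] := normal_triangulation apt feas.
eexists; apply: (@represents_cones _ _ P I T y).
- by move=> i; case: (TP i).
- by move=> i; rewrite PE; case: (yP i).
- move=> i x z; apply: (@basis_cone_min (T i) (idx i)).
  + by case: (TP i).
  + by case: (TP i).
  + by case: (yP i).
- by move=> s v /epi_recession; apply: cover.
move=> i j /sep [n n0 [n1 n2 _]]; exists n => // x /n1 ? /n2 ?.
by apply/eqP; rewrite eq_le; apply/andP.
Qed.

(** The epigraph lies above the hyperplane orthogonal to a line of [P], so it is generically empty
    and the empty family decomposes it. *)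
Lemma represents_not_pointed : ~ pointed a -> represents P (0 : K).
Proof.
move=> napt; have [l la l0] : exists2 l, (forall i, dot (a i) l = 0) & l != 0.
  by apply: contra_notP napt => H l la; apply: contrapT => /eqP l0; apply: H; exists l.
exists 'I_0, (fun=> 0); split; [by case| |by rewrite big_ord0].
have pl0 : pt 0 l != 0 by rewrite pt_eq0 negb_and l0 orbT.
apply: generically_imp (generically_neq pl0) => x; rewrite (pt_surj x).
rewrite dot_pt mul0r add0r => lx; rewrite big_ord0 indic_asbool.
rewrite (_ : `[< _ >] = false)//; apply/asboolP => /epi_recession rx.
move/eqP: lx; apply; rewrite dotC; apply/eqP; rewrite eq_le.
rewrite -oppr_ge0 -dotNr !rx// => i; rewrite ?dotNr la ?oppr0//.
Qed.

(* A flat [P] has an epigraph invariant along a line on which the pairing does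
   not vanish, so it is invisible to [sigma]. *)
Lemma represents_flat n c (f : K) : n != 0 -> (forall y, P y -> dot n y = c) ->
  represents P f -> f = 0.
Proof.
move=> n0 Hn [I [V [Vu gen ->]]].
have un0 : pt (- c) n != 0 by rewrite pt_eq0 negb_and n0 orbT.
rewrite -[RHS](@sigma_fibrewise R K (cst_morphism (R := R) (d := d)) d
  (@sigma_additiveT R K _ d) I predT (fun=> 1) V (variables (R := R) (d := d))
  (\1_(epi P)) (pt (- c) n)).
- by apply: eq_bigr => i _; rewrite rmorph1 mul1r.
- by move=> i _; exact: Vu.
- by move=> i j _; rewrite pairing_variables_neq0// row_unitmx_neq0.
- exact: pairing_variables_neq0.
- move=> t x; rewrite !indic_asbool; congr (nat_of_bool _)%:R.
  apply: asbool_equiv_eq; split=> H y Py; have := H y Py.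
    by rewrite dotDl dotZl dot_pt (Hn y Py) mulr1 addNr mulr0 addr0.
  by rewrite dotDl dotZl dot_pt (Hn y Py) mulr1 addNr mulr0 addr0.
by apply: generically_imp gen => x <-; apply: eq_bigr => i _; rewrite mul1r.
Qed.

Section GivenTriangulation.
Variables (k : nat) (T : 'I_k -> 'M[R]_d).
Hypothesis triT : triangulation (normal_fan P) T.

Let Tu i : T i \in unitmx.
Proof. by case: triT => /(_ i)[dT _] _ _ _ _; rewrite unitmxE unitfE. Qed.

(** The fan contains 0, so there is at least one simplicial cone. Its generators are bounded below
    on [P], hence vanish on every line direction, yet they span the space. *)
Lemma triangulation_pointed : pointed a.
Proof.
case: triT => _ sub cover _ _ l la; have [C0 C0N C00] := normal_fan_nonempty P0.
have : [set x | exists2 C, normal_fan P C & C x] 0 by exists C0.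
rewrite -cover => -[i _]; have [C /normal_fanP [y0 Py0 ymin] TC] := sub i.
apply: (unitmx_rows_inj (Tu i)) => j.
have rj : recession_ge0 a (row j (T i)).
  apply: (minimizer_recession Py0); apply: ymin; apply: TC.
  by apply/cone_ofP; [exact: Tu | exact: incone_row].
apply/eqP; rewrite eq_le -oppr_ge0 -dotNr !rj// => i'; rewrite ?dotNr la ?oppr0//.
Qed.

Lemma represents_triangulation_sum : represents P (triangulation_sum P T).
Proof.
have apt := triangulation_pointed; case: triT => _ sub cover inj faces.
have /choice [y Hy] : forall i, exists y0, P y0 /\
    forall x z, incone (T i) x -> P z -> dot x y0 <= dot x z.
  move=> i; have [C /normal_fanP [y0 Py0 ymin] TC] := sub i; exists y0; split=> //.
  by move=> x z Tx Pz; apply: ymin => //; apply: TC; apply/cone_ofP.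
have -> : triangulation_sum P T = \sum_i ratfun_cst `|\det (T i)| /
    \prod_k tofrac (affine_form (pt (- dot (row k (T i)) (y i)) (row k (T i)))).
  apply: eq_bigr => i _; congr (_ / _); apply: eq_bigr => j _; congr tofrac.
  have [Py ymin] := Hy i; rewrite /support_form /affine_form pt0.
  rewrite (support_fun_min Py) => [|z Pz]; last first.
    by apply: ymin => //; apply: incone_row.
  by congr +%R; apply: eq_bigr => l _; rewrite ptS.
apply: represents_cones.
- exact: Tu.
- by move=> i; case: (Hy i).
- by move=> i x z; case: (Hy i) => _; apply.
(* The auxiliary triangulation provides a minimizer of [v], which places [v] in the fan and so in
   the given triangulation. *)
- move=> s v /epi_recession rv.
  have feas : exists y, feasible a b y by move: P0; rewrite PE.
  have [I [T' [y' [idx [TP yP cover' _]]]]] := normal_triangulation apt feas.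
  have [i Ti] := cover' v rv.
  have Py' : P (y' i) by rewrite PE; case: (yP i).
  have [C CN Cv] : exists2 C, normal_fan P C & C v.
    apply: (normal_fan_minimizer Py') => z Pz.
    by apply: (@basis_cone_min (T' i) (idx i)) => //;
      [case: (TP i)|case: (TP i)|case: (yP i)].
  have : [set x | exists2 C, normal_fan P C & C x] v by exists C.
  by rewrite -cover => -[j /cone_ofP]; exists j; auto.
move=> i j ij.
have zero_in l : cone_of (T l) 0.
  by exists 0; split; [move=> ?; rewrite mxE | rewrite mul0mx].
(* The intersection is a face of the first cone: a nonzero functional puts it in a hyperplane, the
   zero one makes it the whole cone. Inclusion both ways would make the cones equal. *)
have alt i1 i2 : (exists2 n, n != 0 & forall x, cone_of (T i1) x ->
     cone_of (T i2) x -> dot n x = 0) \/ cone_of (T i1) `<=` cone_of (T i2).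
  have [_ [al [be [_ E]]]] := faces i1 i2.
  have be0 : be = 0.
    have : (cone_of (T i1) `&` cone_of (T i2)) 0 by split.
    by rewrite E => -[_]; rewrite dot0r.
  have [al0|al0] := eqVneq al 0; [right|left].
    by move=> x Tx; suff [] : (cone_of (T i1) `&` cone_of (T i2)) x;
      rewrite // E al0 be0 /= dot0l.
  exists al => // x Tx Tx'; have : (cone_of (T i1) `&` cone_of (T i2)) x by split.
  by rewrite E be0 => -[].
have [[n n0 Hn]|sub1] := alt i j.
  by exists n => // x /cone_ofP Tx /cone_ofP Tx'; apply: Hn; auto.
have [[n n0 Hn]|sub2] := alt j i.
  by exists n => // x /cone_ofP Tx /cone_ofP Tx'; apply: Hn; auto.
by move/eqP: ij; case; apply: inj; apply/seteqP.
Qed.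

End GivenTriangulation.

(** The cone contains [- a i] for every active [i], and these span. A larger cone of the fan belongs
    to a face on which all these constraints are active, that is, to the vertex. *)
Lemma vertex_cone y0 : is_vertex a b y0 ->
  [/\ normal_fan P (normal_cone P [set y0]),
      lin_dim (normal_cone P [set y0]) = d
    & forall D, normal_fan P D -> normal_cone P [set y0] `<=` D ->
        D = normal_cone P [set y0]].
Proof.
move=> [fy0 y0v]; have Py0 : P y0 by rewrite PE.
have y0P : [set y0] `<=` P by move=> _ ->.
have ne : [set y0] !=set0 by exists y0.
have uniq y : P y -> (forall i, dot (a i) y0 = b i -> dot (a i) y = b i) -> y = y0.
  move=> Py H; apply/eqP; rewrite -subr_eq0; apply/eqP/y0v => i /[dup] /H.
  by rewrite dotBr => -> ->; rewrite subrr.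
have inC i : dot (a i) y0 = b i -> normal_cone P [set y0] (- a i).
  move=> ai; apply/normal_coneP => // _ z -> Pz; rewrite !dotNl lerN2 ai.
  by move: Pz; rewrite PE; apply.
(* This functional is minimal on [P] only where all constraints active at [y0] are active, that is,
   at [y0]. *)
pose al := - \sum_(i | dot (a i) y0 == b i) a i.
split.
- exists [set y0] => //; split=> //; exists al, (dot al y0).
  have le y : P y -> \sum_(i | dot (a i) y0 == b i) dot (a i) y <=
      \sum_(i | dot (a i) y0 == b i) dot (a i) y0.
    move=> Py; apply: ler_sum => i /eqP ->; move: Py; rewrite PE; apply.
  split; first by move=> y Py; rewrite /al !dotNl !dot_suml lerN2 le.
  apply/seteqP; split=> [_ ->//|y [Py]]; rewrite /al !dotNl !dot_suml => /oppr_inj E.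
  apply: uniq => // i ai.
  have : \sum_(i | dot (a i) y0 == b i) (dot (a i) y0 - dot (a i) y) == 0.
    by rewrite sumrB E subrr.
  rewrite psumr_eq0 => [|j /eqP ->]; last first.
    by rewrite subr_ge0; move: Py; rewrite PE; apply.
  move=> /allP/(_ i (mem_index_enum i)); rewrite ai eqxx subr_eq0 => /eqP.
  by move=> <-.
- apply: lin_dim_spanning => n Hn; apply: y0v => i /inC/Hn.
  by rewrite dotNr dotC => /eqP; rewrite oppr_eq0 => /eqP.
move=> _ [F fF ->] sub; have [[y1 Fy1] _] := fF.
suff Fy y : F y -> y = y0.
  rewrite (_ : F = [set y0])//; apply/seteqP; split=> [y /Fy//|_ ->].
  by rewrite -(Fy y1).
move=> Fy; apply: uniq; first exact: face_sub fF _ Fy.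
move=> i /[dup] ai /inC/sub.
move=> /(normal_coneP _ (ex_intro _ y1 Fy1) (face_sub fF)) /(_ y y0 Fy Py0).
rewrite !dotNl lerN2 ai => bi; apply/eqP; rewrite eq_le bi andbT.
by have := face_sub fF Fy; rewrite PE; apply.
Qed.

Lemma vertex_exists : pointed a -> exists y0, is_vertex a b y0.
Proof.
move=> apt; have [y0 Py0] := P0; have fy0 : feasible a b y0 by move: Py0; rewrite PE.
have [|y1 y1v _] := vertex_descent apt (v := 0) _ fy0; last by exists y1.
by move=> l _; rewrite dot0l.
Qed.

Lemma pure_pointed_eq k : pointed a -> pure (normal_fan P) k -> k = d.
Proof.
move=> /vertex_exists [y0 /vertex_cone [Cn Cd Cmax]] /(_ _ Cn Cmax) <-.
exact: Cd.
Qed.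

(** Every face contains a vertex, whose normal cone is larger; so the maximal cones are those of
    vertices. *)
Lemma pure_pointed : pointed a -> pure (normal_fan P) d.
Proof.
move=> apt C [F fF ->] Cmax; have FP := face_sub fF; have [ne [al [be [alP FE]]]] := fF.
have [y Fy] := ne; have fy : feasible a b y by have := FP _ Fy; rewrite PE.
have yal : dot al y = be by move: Fy; rewrite FE => -[].
have ral : recession_ge0 a al.
  by apply: (minimizer_recession (FP _ Fy)) => z; rewrite yal; exact: alP.
have [y0 y0v y0le] := vertex_descent apt ral fy.
have Py0 : P y0 by rewrite PE; case: y0v.
have Fy0 : F y0.
  by rewrite FE; split=> //; apply/eqP; rewrite eq_le alP// andbT -yal.
have [Cn Cd _] := vertex_cone y0v.
rewrite -(Cmax _ Cn)// => v /(normal_coneP _ ne FP) Hv; apply/normal_coneP.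
- by exists y0.
- by move=> _ ->.
by move=> _ z -> Pz; apply: Hv.
Qed.

(** The face is where the sum of the generators is minimal: as each generator is minimal at [y0], a
    minimizer of the sum minimizes all of them. *)
Lemma cone_in_normal_fan (T : 'M[R]_d) y0 : T \in unitmx -> P y0 ->
  (forall x z, incone T x -> P z -> dot x y0 <= dot x z) ->
  exists2 C, normal_fan P C & cone_of T `<=` C.
Proof.
move=> Tu Py0 Tmin; pose v := \sum_k row k T.
have vT : incone T v.
  rewrite /v (eq_bigr (fun k => 1 *: row k T)) => [|k _]; last by rewrite scale1r.
  by apply: incone_comb => // k _; exact: incone_row.
have vmin z : P z -> dot v y0 <= dot v z by exact: Tmin.
exists (normal_cone P [set y | P y /\ dot v y = dot v y0]).
  by exists [set y | P y /\ dot v y = dot v y0] => //; exact: face_minimizers.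
move=> x /(cone_ofP _ Tu) Tx; apply/normal_coneP => [|y []//|y z [Py yv] Pz].
  by exists y0.
suff -> : dot x y = dot x y0 by exact: Tmin.
rewrite (incone_sum x Tu) !dot_suml; apply: eq_bigr => k _; rewrite !dotZl.
congr (_ * _); have : \sum_k (dot (row k T) y - dot (row k T) y0) == 0.
  by rewrite sumrB -!dot_suml -/v yv subrr.
rewrite psumr_eq0 => [/allP/(_ k (mem_index_enum k))|j _].
  by rewrite subr_eq0 => /eqP.
by rewrite subr_ge0 Tmin// incone_row.
Qed.

(** Taking midpoints successively keeps the inequalities already strict and adds a new one; this
    replaces relative interior points. *)
Lemma strict_point (S : set 'rV[R]_d) : S !=set0 -> is_convex S -> S `<=` P ->
  exists2 p, S p & forall i, (exists2 y, S y & dot (a i) y < b i) ->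
    dot (a i) p < b i.
Proof.
move=> [y0 Sy0] vS SP.
suff [p Sp Hp] : exists2 p, S p & forall i, i \in enum 'I_m ->
    (exists2 y, S y & dot (a i) y < b i) -> dot (a i) p < b i.
  by exists p => // i; apply: Hp; rewrite mem_enum.
elim: (enum 'I_m) => [|i r [p Sp Hp]]; first by exists y0.
have le j y : S y -> dot (a j) y <= b j by move=> /SP; rewrite PE; apply.
have [[y Sy yi]|none] := pselect (exists2 y, S y & dot (a i) y < b i); last first.
  by exists p => // j; rewrite inE => /predU1P[-> //|]; exact: Hp.
exists (p + 2^-1 *: (y - p)); first by apply: vS => //; lra.
move=> j jr Hj; rewrite dotDr dotZr dotBr; have := le j p Sp; have := le j y Sy.
move: jr; rewrite inE => /predU1P[->|jr]; first by lra.
by have := Hp j jr Hj; lra.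
Qed.

Hypothesis a_neq0 : forall i, a i != 0.
Hypothesis irredundant : forall i, exists2 q,
  b i < dot (a i) q & forall j, j != i -> dot (a j) q <= b j.

(** By irredundancy the segment from an interior point [p] to [q] leaves [P] through constraint [i]
    alone. At the exit point [y0] only this constraint is active, so the normal cone is the ray of
    [- a i]. *)
Lemma facet_ray : full_dimensional P -> is_convex P ->
  forall i, ray_generator (normal_fan P) (- a i).
Proof.
move=> fP vP i; split; first by rewrite oppr_eq0 a_neq0.
have [p Pp pint] : exists2 p, P p & forall j, dot (a j) p < b j.
  have [|p Pp Hp] := strict_point P0 vP; first by [].
  exists p => // j; apply: Hp; apply: contrapT => none.
  move/eqP: (a_neq0 j); apply; apply: (full_dimensional_not_flat fP (c := b j)) => y Py.
  apply/eqP; rewrite eq_le leNgt; apply/andP; split.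
    by move: Py; rewrite PE => /(_ j); rewrite leNgt.
  by rewrite leNgt; apply/negP => yj; apply: none; exists y.
have [q qi qj] := irredundant i.
pose th := (b i - dot (a i) p) / (dot (a i) q - dot (a i) p).
have den : 0 < dot (a i) q - dot (a i) p by have := pint i; lra.
have th0 : 0 < th by rewrite divr_gt0// subr_gt0.
have th1 : th < 1 by rewrite ltr_pdivrMr// mul1r; lra.
pose y0 := p + th *: (q - p).
have y0i : dot (a i) y0 = b i.
  by rewrite dotDr dotZr dotBr divfK ?lt0r_neq0// addrC subrK.
have y0j j : j != i -> dot (a j) y0 < b j.
  by move=> ji; rewrite dotDr dotZr dotBr; have := pint j; have := qj j ji; nra.
have Py0 : P y0.
  by rewrite PE => j; have [->|/y0j/ltW//] := eqVneq j i; rewrite y0i.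
pose F := [set y | P y /\ dot (- a i) y = dot (- a i) y0].
have ymin y : P y -> dot (- a i) y0 <= dot (- a i) y.
  by move=> Py; rewrite !dotNl lerN2 y0i; move: Py; rewrite PE; apply.
exists F; first exact: face_minimizers.
apply/seteqP; split=> [x [c [c0 ->]]|v].
  have -> : c *m - a i = c 0 0 *: - a i.
    by rewrite {1}[c]mx11_scalar mul_scalar_mx.
  apply/normal_coneP => [|y []//|y z [_ yE] Pz]; first by exists y0.
  by rewrite !dotZl ler_wpM2l// yE ymin.
move=> /normal_coneP Hv.
have {}Hv z : P z -> dot v y0 <= dot v z.
  by move=> Pz; apply: Hv => //; [exists y0 | move=> y []].
have dir l : dot (a i) l <= 0 -> 0 <= dot v l.
  move=> li; have [e e0 He] := small_step (fun j => b j - dot (a j) y0)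
    (fun j => dot (a j) l).
  have : P (y0 + e *: l).
    rewrite PE => j; rewrite dotDr dotZr; have [->|ji] := eqVneq j i.
      by rewrite y0i; nra.
    have := He j; rewrite subr_gt0 => /(_ (y0j j ji)).
    by have := ler_norm (dot (a j) l); nra.
  by move=> /Hv; rewrite dotDr dotZr; nra.
have aa := dot_gt0 (a_neq0 i).
(* Makes [v + c *: a i] orthogonal to [a i]; testing [v] on the opposite of this vector shows that
   it is 0. *)
pose c := - dot v (a i) / dot (a i) (a i).
have c0 : 0 <= c.
  by rewrite divr_ge0 ?(ltW aa)// -dotNr dir// dotNr; lra.
have cE : c * dot (a i) (a i) = - dot v (a i) by rewrite divfK ?lt0r_neq0.
have ort : dot (a i) (v + c *: a i) = 0 by rewrite dotDr dotZr cE dotC; lra.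
exists c%:M; split; first by move=> j; rewrite (ord1 j) mxE eqxx mulr1n.
rewrite mul_scalar_mx scalerN; apply/eqP; rewrite -addr_eq0 -dot_eq0 eq_le dot_ge0.
rewrite andbT dotDl dotZl ort mulr0 addr0 -oppr_ge0 -dotNr dir//.
by rewrite dotNr ort oppr0.
Qed.

Lemma triangulation_exists : full_dimensional P -> is_convex P -> pointed a ->
  exists (k : nat) (T : 'I_k -> 'M[R]_d), triangulation (normal_fan P) T.
Proof.
move=> fP vP apt; have feas : exists y, feasible a b y by move: P0; rewrite PE.
have [I [T [y [idx [TP yP cover sep]]]]] := normal_triangulation apt feas.
have Tu i : T i \in unitmx by case: (TP i).
have Py i : P (y i) by rewrite PE; case: (yP i).
have Tmin i x z : incone (T i) x -> P z -> dot x (y i) <= dot x z.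
  by apply: (@basis_cone_min (T i) (idx i)) => //; [case: (TP i)|case: (yP i)].
have zero_in l : cone_of (T l) 0.
  by exists 0; split; [move=> ?; rewrite mxE | rewrite mul0mx].
exists #|I|, (fun i => T (enum_val i)); split.
- move=> i; split=> [|j]; first by rewrite -unitfE -unitmxE.
  by have [_ ->] := TP (enum_val i); apply: facet_ray.
- by move=> i; apply: (cone_in_normal_fan (Tu _) (Py (enum_val i))) => x z; exact: Tmin.
- apply/seteqP; split=> [x [i Tx]|x [C /normal_fanP [y0 Py0 ymin] Cx]].
    have [C CN TC] := cone_in_normal_fan (Tu _) (Py (enum_val i)) (Tmin (enum_val i)).
    by exists C => //; exact: TC.
  have [|i Ti] := cover x; first by apply: (minimizer_recession Py0); exact: ymin.
  by exists (enum_rank i); rewrite enum_rankK; apply/cone_ofP.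
(* Equal cones would lie in the hyperplane separating them, but their generators span. *)
- move=> i j E; apply: contrapT => /eqP ij.
  have ij' : enum_val i != enum_val j by rewrite (inj_eq enum_val_inj).
  have [n /eqP n0 [n1 n2 _]] := sep _ _ ij'; apply: n0.
  apply: (unitmx_rows_inj (Tu (enum_val i))) => k; rewrite dotC.
  apply/eqP; rewrite eq_le n1 ?incone_row// n2//.
  by apply/cone_ofP => //; rewrite -E; apply/cone_ofP => //; exact: incone_row.
move=> i j; split; first by exists 0; split.
have [->|ij] := eqVneq i j.
  exists 0, 0; split=> [x _|]; first by rewrite dot0l.
  by rewrite setIid; apply/seteqP; split=> [x Tx|x []//]; split=> //; rewrite dot0l.
have ij' : enum_val i != enum_val j by rewrite (inj_eq enum_val_inj).
have [n n0 [n1 n2 n3]] := sep _ _ ij'; exists n, 0; split.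
  by move=> x /(cone_ofP _ (Tu _)); exact: n1.
apply/seteqP; split=> x.
  move=> [Tx Tx']; split=> //; apply/eqP; rewrite eq_le n1 ?n2//.
    exact/cone_ofP.
  exact/cone_ofP.
by move=> [Tx nx]; split=> //; apply/cone_ofP => //; apply: n3 => //; exact/cone_ofP.
Qed.

End Presentation.

(** * Linear relations between dual volumes and their values at 0 *)

Section DualVolume.
Context {R : realType} {d : nat}.
Local Notation K := {fraction (mpoly d R)}.
Local Open Scope classical_set_scope.
Implicit Types (P F : set 'rV[R]_d) (f g : K).

Lemma irredundant_presentation P : polyhedron P ->
  exists (m : nat) (a : 'I_m -> 'rV[R]_d) (b : 'I_m -> R),
  [/\ P = [set y | feasible a b y], forall i, a i != 0
    & forall i, exists2 q, b i < dot (a i) q &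
        forall j, j != i -> dot (a j) q <= b j].
Proof.
move=> [_ [m [a [b [a0 PE]]]]]; elim: m a b a0 PE => [|m IH] a b a0 PE.
  by exists 0%N, a, b; split=> // -[].
have [irr|red] := pselect (forall i, exists2 q, b i < dot (a i) q &
    forall j, j != i -> dot (a j) q <= b j).
  by exists m.+1, a, b; split.
have [i Hi] : exists i, forall q, (forall j, j != i -> dot (a j) q <= b j) ->
    dot (a i) q <= b i.
  apply: contrapT => none; apply: red => i; apply: contrapT => noq; apply: none.
  exists i => q Hq; rewrite leNgt; apply/negP => qi; apply: noq.
  by exists q.
apply: (IH (a \o lift i) (b \o lift i)); first by move=> j; exact: a0.
rewrite PE; apply/seteqP; split=> y /= H j; first exact: H.
case: (unliftP i j) => [l ->|->]; first exact: H.
by apply: Hi => l; case: (unliftP i l) => [l' -> _|->]; [exact: H | rewrite eqxx].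
Qed.

(** Whichever clause and triangulation [xget] selects, the result represents [P]. *)
Lemma represents_dual_volume_z P : polyhedron P -> represents P (dual_volume_z P).
Proof.
move=> pP; have P0 := pP.1; have vP := polyhedron_convex pP.
have [m [a [b [PE a0 irr]]]] := irredundant_presentation pP.
have zero_rep : ~ (full_dimensional P /\ pointed a) -> represents P (0 : K).
  move=> H; have [apt|napt] := pselect (pointed a); last first.
    exact: (represents_not_pointed PE).
  have [f rf] := represents_pointed PE P0 apt.
  have [|n [c [n0 Hn]]] := flat_not_full_dimensional P0 (_ : ~ full_dimensional P).
    by move=> fP; apply: H.
  by rewrite -(represents_flat n0 Hn rf).
rewrite /dual_volume_z; case: xgetP =>
  [f _ [[fP _ [k [T [triT ->]]]]|[fP [k [kd pk]] ->]|[nfP ->]]|none].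
- exact: (represents_triangulation_sum PE).
- apply: zero_rep => -[_ apt]; move: kd.
  by rewrite (pure_pointed_eq PE P0 apt pk) ltnn.
- by apply: zero_rep => -[].
(* The default value 0 of [xget] is harmless: a full-dimensional pointed polyhedron does have a
   triangulation. *)
apply: zero_rep => -[fP apt].
have [k [T triT]] := triangulation_exists PE P0 a0 irr fP vP apt.
apply: (none (triangulation_sum P T)); apply: Or31; split=> //.
  exact: (pure_pointed PE P0 apt).
by exists k, T.
Qed.

Lemma dual_volume_z_relation (I : finType) (alpha : I -> R)
    (P : I -> set 'rV[R]_d) :
  (forall i, polyhedron (P i)) ->
  (forall x, \sum_i alpha i * \1_(P i) x = 0) ->
  \sum_i ratfun_cst (alpha i) * dual_volume_z (P i) = 0.
Proof.
move=> pP sum0.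
have /choice [X HX] : forall i, exists X : {J : finType & J -> 'M[R]_d.+1},
    [/\ forall j, tagged X j \in unitmx,
        generically (fun x => \sum_j (incone (tagged X j) x)%:R = \1_(epi (P i)) x :> R)
      & dual_volume_z (P i) = \sum_j sigma (cst_morphism (R := R) (d := d))
          (variables (R := R) (d := d)) (tagged X j)].
  move=> i; have [J [V HV]] := represents_dual_volume_z (pP i).
  by exists (Tagged (fun J : finType => J -> 'M[R]_d.+1) V).
(* All decompositions are merged into one family, indexed by dependent pairs, to apply additivity
   once. *)
pose J i := tag (X i); pose V i : J i -> _ := tagged (X i).
have := @sigma_additiveT R K (cst_morphism (R := R) (d := d)) d.+1
  {i : I & J i} predT (fun p => alpha (tag p)) (fun p => V (tag p) (tagged p))
  (variables (R := R) (d := d)).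
move=> H; rewrite -[RHS]H => [|p _|p j _|].
- rewrite -(sig_big_dep (fun=> true) (fun _ _ => true) (fun i j =>
    cst_morphism (alpha i) * sigma cst_morphism variables (V i j))) /=.
  by apply: eq_bigr => i _; have [_ _ ->] := HX i; rewrite mulr_sumr.
- by have [Vu _ _] := HX (tag p); exact: Vu.
- by have [Vu _ _] := HX (tag p); rewrite pairing_variables_neq0// row_unitmx_neq0// Vu.
have gen : generically (fun x : 'rV[R]_d.+1 => forall i,
    \sum_j (incone (V i j) x)%:R = \1_(epi (P i)) x :> R).
  by apply: generically_fin => i; have [_ gi _] := HX i.
apply: generically_imp gen => x Hx.
rewrite -(sig_big_dep (fun=> true) (fun _ _ => true) (fun i j =>
    alpha i * (incone (V i j) x)%:R)) /= -[RHS](epi_relation pP sum0 x).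
by apply: eq_bigr => i _; rewrite -mulr_sumr Hx.
Qed.

Lemma ratfun_value_cst c z : ratfun_value (ratfun_cst c : K) z c.
Proof.
exists (mpolyC d c), 1; split; first by rewrite meval1 oner_neq0.
  by rewrite tofrac1 divr1.
by rewrite meval1 divr1 mevalC.
Qed.

Lemma ratfun_value0 z : ratfun_value (0 : K) z 0.
Proof. by have := ratfun_value_cst 0 z; rewrite /ratfun_cst mpolyC0 tofrac0. Qed.

Lemma ratfun_valueD f g z x y : ratfun_value f z x -> ratfun_value g z y ->
  ratfun_value (f + g) z (x + y).
Proof.
move=> [p [q [q0 -> ->]]] [p' [q' [q'0 -> ->]]].
have tq (r : mpoly d R) : meval (z 0) r != 0 -> tofrac r != 0.
  by apply: contraNN; rewrite tofrac_eq0 => /eqP ->; rewrite meval0.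
exists (p * q' + p' * q), (q * q'); split.
- by rewrite mevalM mulf_neq0.
- by rewrite addf_div ?tq// tofracD !tofracM.
by rewrite addf_div// mevalD !mevalM.
Qed.

Lemma ratfun_valueM f g z x y : ratfun_value f z x -> ratfun_value g z y ->
  ratfun_value (f * g) z (x * y).
Proof.
move=> [p [q [q0 -> ->]]] [p' [q' [q'0 -> ->]]].
exists (p * p'), (q * q'); split.
- by rewrite mevalM mulf_neq0.
- by rewrite mulf_div !tofracM.
by rewrite mulf_div !mevalM.
Qed.

Lemma ratfun_value_sum (I : finType) (f : I -> K) (x : I -> R) z :
  (forall i, ratfun_value (f i) z (x i)) ->
  ratfun_value (\sum_i f i) z (\sum_i x i).
Proof.
move=> H; elim: (index_enum I) => [|i r IH].
  by rewrite !big_nil; exact: ratfun_value0.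
by rewrite !big_cons; apply: ratfun_valueD.
Qed.

Lemma ratfun_value_eq0 z x : ratfun_value (0 : K) z x -> x = 0.
Proof.
move=> [p [q [q0 E ->]]]; suff -> : p = 0 by rewrite meval0 mul0r.
apply/eqP; rewrite -tofrac_eq0; move/esym/eqP: E; rewrite mulf_eq0 invr_eq0.
rewrite !tofrac_eq0 => /orP[//|/eqP qE].
by move: q0; rewrite qE meval0 eqxx.
Qed.

Lemma cone_of_row (v : 'rV[R]_d) : cone_of v v.
Proof.
exists 1%:M; rewrite mul1mx; split=> // j.
by rewrite mxE; exact: ler0n.
Qed.

Lemma cone_of_rowP (v x : 'rV[R]_d) : cone_of v x -> exists c, x = c *: v.
Proof.
by move=> [c [_ ->]]; exists (c 0 0); rewrite {1}[c]mx11_scalar mul_scalar_mx.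
Qed.

(** The face [F] with normal cone spanned by [v] is a facet. If the support function vanished at
    [v], the facet would span a hyperplane through the origin. *)
Lemma ray_support_neq0 P v : polyhedron P -> full_dimensional P ->
  non_codegenerate P -> ray_generator (normal_fan P) v ->
  fine (support_fun P v) != 0.
Proof.
move=> pP fP ncP [v0 [F fF vF]]; have P0 := pP.1; have vP := polyhedron_convex pP.
have [m [a [b [PE _ _]]]] := irredundant_presentation pP.
have FP := face_sub fF; have [ne [al [be [alP FE]]]] := fF.
have inC x : normal_cone P F x -> exists c, x = c *: v.
  by rewrite -vF; exact: cone_of_rowP.
have vmin y z : F y -> P z -> dot v y <= dot v z.
  move=> Fy Pz; have : normal_cone P F v by rewrite -vF; exact: cone_of_row.
  by move=> /(normal_coneP _ ne FP); apply.
have cF : is_convex F.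
  move=> x y t; rewrite FE => -[Px xb] [Py yb] t01; split; first exact: vP.
  by rewrite dotDr dotZr dotBr xb yb subrr mulr0 addr0.
have [p Fp pstrict] := strict_point PE ne cF FP.
have Pp : P p := FP _ Fp.
(* Constraints active at [p] are active on all of [F], so their normals are multiples of [v]. *)
have tangent l : dot v l = 0 -> forall i, dot (a i) p = b i -> dot (a i) l = 0.
  move=> vl i pi; have [|c /eqP] := inC (- a i).
    apply/(normal_coneP _ ne FP) => y z Fy Pz; rewrite !dotNl lerN2.
    have -> : dot (a i) y = b i.
      apply/eqP; rewrite eq_le; apply/andP; split.
        by move: (FP _ Fy); rewrite PE; apply.
      rewrite leNgt; apply/negP => yi.
      by have := pstrict i (ex_intro2 _ _ y Fy yi); rewrite pi ltxx.
    by move: Pz; rewrite PE; apply.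
  by rewrite eqr_oppLR => /eqP ->; rewrite dotNl dotZl vl mulr0 oppr0.
have step (J : finType) (l : J -> 'rV[R]_d) : (forall j, dot v (l j) = 0) ->
    exists2 e, 0 < e & forall j, F (p + e *: l j).
  move=> vl; have [e e0 He] := small_step (fun ij : 'I_m * J => b ij.1 - dot (a ij.1) p)
    (fun ij => dot (a ij.1) (l ij.2)).
  exists e => // j; rewrite FE; split.
    rewrite PE => i; rewrite dotDr dotZr.
    have [pi|pi] := eqVneq (dot (a i) p) (b i).
      by rewrite (tangent _ (vl j) i pi) mulr0 addr0 pi.
    have pi' : 0 < b i - dot (a i) p.
      by rewrite subr_gt0 lt_neqAle pi; move: Pp; rewrite PE; apply.
    by have := He (i, j) pi'; have := ler_norm (dot (a i) (l j)) => /=; nra.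
  have [|c alE] := inC al.
    by apply/(normal_coneP _ ne FP) => y z; rewrite FE => -[_ ->]; exact: alP.
  have : dot al p = be by move: Fp; rewrite FE => -[].
  by rewrite alE !dotZl dotDr dotZr vl mulr0 addr0.
rewrite (support_fun_min Pp (fun y Py => vmin p y Fp Py)) /= oppr_eq0.
apply/eqP => vp; apply: (ncP F).
  split=> //; rewrite fP; apply/eqP; rewrite eqn_leq; apply/andP; split.
    apply: (lin_dim_hyperplane v0) => _ [x Fx [y Fy <-]]; rewrite dotBr.
    by apply/eqP; rewrite subr_eq0 eq_le !vmin// ?FP//; exact: FP.
  (* A basis of the hyperplane orthogonal to [v]; short steps along it stay in [F], which therefore
     has dimension [d.-1]. *)
  pose B := row_base (kermx v^T).
  have rB : \rank (kermx v^T) = d.-1 by rewrite mxrank_ker mxrank_tr rank_rV v0 subn1.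
  have vB k : dot v (row k B) = 0.
    have /sub_kermxP BE : (B <= kermx v^T)%MS by rewrite eq_row_base.
    by rewrite dotC dotE -row_mul BE !mxE.
  have [e e0 He] := step _ (fun k => row k B) vB.
  have eB : row_free (e *: B).
    rewrite /row_free (eqmx_scale _ (lt0r_neq0 e0)).
    exact: row_base_free.
  suff : (d.-1 <= aff_dim F)%N by rewrite -ltnS; apply: leq_trans; exact: leqSpred.
  rewrite -rB; apply: (lin_dim_ge eB) => k.
  exists (p + e *: row k B); first exact: He.
  by exists p => //; rewrite addrC addKr; apply/rowP => j; rewrite !mxE.
(* If [v] vanishes at [p], a short step towards the origin stays in [F], and 0 is an affine
   combination of its two ends. *)
have [|e e0 He] := step unit (fun=> - p); first by rewrite dotNr vp oppr0.
exists 2%N, (fun i => if i == ord0 then p else p + e *: - p),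
  (fun i => if i == ord0 then 1 - e^-1 else e^-1); split.
- by move=> i; case: ifP => _ //; exact: (He tt).
- by rewrite !big_ord_recl big_ord0 /=; lra.
rewrite !big_ord_recl big_ord0 /= addr0 scalerDr scalerA mulVf ?lt0r_neq0//.
by rewrite scale1r addrA -scalerDl subrK scale1r subrr.
Qed.

Lemma meval_prod (I : finType) (F : I -> mpoly d R) (v : 'I_d -> R) :
  meval v (\prod_i F i) = \prod_i meval v (F i).
Proof. by rewrite rmorph_prod. Qed.

(** At z = 0 the denominators are products of support function values at rays, nonzero by
    [ray_support_neq0]. *)
Lemma dual_volumeP P : polyhedron P -> non_codegenerate P ->
  ratfun_value (dual_volume_z P) 0 (dual_volume P).
Proof.
move=> pP ncP; suff [x Hx] : exists x, ratfun_value (dual_volume_z P) 0 x.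
  by rewrite /dual_volume; case: xgetP => [y _ //|/(_ x)].
rewrite /dual_volume_z; case: xgetP =>
  [f _ [[fP _ [k [T [[rays _ _ _ _] ->]]]]|[_ _ ->]|[_ ->]]|_];
  try by exists 0; exact: ratfun_value0.
eexists; apply: ratfun_value_sum => i; apply: ratfun_valueM.
  exact: ratfun_value_cst.
exists 1, (\prod_j support_form P (row j (T i))); split; last by [].
  rewrite meval_prod prodf_seq_neq0; apply/allP => j _ /=.
  have [_ rj] := rays i; rewrite mevalD mevalC rmorph_sum /= big1 ?addr0.
    exact: ray_support_neq0.
  by move=> l _; rewrite mevalZ mevalXU [X in _ * X]mxE mulr0.
by rewrite tofrac1 div1r rmorph_prod.
Qed.

End DualVolume.

Theorem theorem3p1 (R : realType) (d r : nat)
    (P : 'I_r -> set 'rV[R]_d) (alpha : 'I_r -> R)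
    (polyP : forall i : 'I_r, polyhedron (P i))
    (sum_indic : forall x : 'rV[R]_d, \sum_(i < r) alpha i * \1_(P i) x = 0) :
  \sum_(i < r) ratfun_cst (alpha i) * dual_volume_z (P i) = 0 :> {fraction (mpoly d R)}
  /\ ((forall i : 'I_r, non_codegenerate (P i)) ->
      \sum_(i < r) alpha i * dual_volume (P i) = 0).
Proof.
have sumz := dual_volume_z_relation polyP sum_indic.
split=> // ncP; apply: (@ratfun_value_eq0 R d 0); rewrite -sumz.
apply: ratfun_value_sum => i; apply: ratfun_valueM; first exact: ratfun_value_cst.
exact: dual_volumeP.
Qed.
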